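(* Let $\Gamma=(\Gamma,\alpha,\theta)$ be a torus graph. Then the equivariant cohomology $H^*_T(\Gamma)$ is isomorphic as a graded ring to the face ring $\mathbb Z[\mathcal P(\Gamma)]$ of the simplicial poset $\mathcal P(\Gamma)$ of faces of $\Gamma$. In other words, $H^*_T(\Gamma)$ is isomorphic to the quotient of the graded polynomial ring generated by the Thom classes $\tau_F$ (i.e. the polynomial ring on generators $v_F$, $\deg v_F=2(n-\dim F)$, one for each proper non-empty face $F$ of $\Gamma$, with $v_F$ corresponding to $\tau_F$) modulo the relations $$v_Gv_H=v_{G\vee H}\cdot\sum_{E\in G\cap H}v_E$$ for all faces $G,H$ of $\Gamma$, where the sum is over the connected components $E$ of $G\cap H$, and formally $v_\Gamma=1$, $v_\varnothing=0$ (so the right-hand side is $0$ if $G\cap H=\varnothing$).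
   Context: Torus graphs. Let $T=T^n$ be the $n$-dimensional torus; $H^2(BT)=\mathrm{Hom}(T,S^1)\cong\mathbb Z^n$ and $H^*(BT)$ (integer coefficients) is the polynomial ring on $H^2(BT)$, graded with generators in degree 2. Let $\Gamma$ be a finite connected regular $n$-valent graph without loops (multiple edges allowed), $V(\Gamma)$ its vertices, $E(\Gamma)$ its oriented edges (each edge occurs with both orientations), $i(e),t(e)$ the initial and terminal vertices of $e$, $\bar e$ the reversed edge, $E(\Gamma)_p=\{e: i(e)=p\}$. A connection $\theta$ is a collection of bijections $\theta_e\colon E(\Gamma)_{i(e)}\to E(\Gamma)_{t(e)}$, $e\in E(\Gamma)$, with $\theta_{\bar e}=\theta_e^{-1}$ and $\theta_e(e)=\bar e$. A torus axial function is a map $\alpha\colon E(\Gamma)\to H^2(BT)$ such that (a) $\alpha(\bar e)=\pm\alpha(e)$; (b) $\alpha(E(\Gamma)_p)$ is a basis of $H^2(BT)$ for each vertex $p$; (c) $\alpha(\theta_e(e'))\equiv\alpha(e')\bmod\alpha(e)$ for all $e$ and $e'\in E(\Gamma)_{i(e)}$. The triple $(\Gamma,\alpha,\theta)$ is a torus graph ($\theta$ is then determined by $\alpha$). Equivariant cohomology. Let $T_e=\ker\alpha(e)\subset T$. $H^*_T(\Gamma)$ is the ring (vertexwise operations) of maps $f\colon V(\Gamma)\to H^*(BT)$ such that for every $e\in E(\Gamma)$ the restrictions of $f(i(e))$ and $f(t(e))$ to $H^*(BT_e)$ coincide, i.e. $f(i(e))\equiv f(t(e))\bmod \alpha(e)$.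 Faces. A $k$-dimensional face ($0\le k\le n$) is a connected regular $k$-valent subgraph $F$ of $\Gamma$ invariant under the connection (for every oriented edge $e$ of $F$, $\theta_e$ maps the edges of $F$ at $i(e)$ to those of $F$ at $t(e)$). Connected components of an intersection of faces are faces. For faces $G,H$ with $G\cap H\neq\varnothing$, $G\vee H$ is the unique minimal face containing both. The Thom class of a $k$-face $F$ is $\tau_F\in H^{2(n-k)}_T(\Gamma)$, $\tau_F(p)=\prod_{i(e)=p,\ e\notin F}\alpha(e)$ if $p\in V(F)$ and $\tau_F(p)=0$ otherwise. Simplicial posets. A finite poset $\mathcal P$ is simplicial if it has an initial element $\hat 0$ and each lower segment $[\hat0,\sigma]$ is a boolean lattice; $\mathrm{rk}\,\sigma=k$ if $[\hat 0,\sigma]$ is the face poset of a $(k-1)$-simplex. The face ring is $\mathbf k[\mathcal P]=\mathbf k[v_\sigma:\sigma\in\mathcal P\setminus\hat0]/\mathcal I_{\mathcal P}$, $\deg v_\sigma=2\,\mathrm{rk}\,\sigma$, where $\mathcal I_{\mathcal P}$ is generated by $v_\sigma v_\tau-v_{\sigma\wedge\tau}\sum_{\eta\in\sigma\vee\tau}v_\eta$; here $\sigma\vee\tau$ is the set of minimal common upper bounds, $\sigma\wedge\tau$ is the greatest common lower bound (unique when $\sigma\vee\tau\ne\varnothing$), $v_{\hat0}=1$ and an empty sum is $0$. The faces of a torus graph $\Gamma$ ordered by reversed inclusion form a simplicial poset $\mathcal P(\Gamma)$ of rank $n$, in which the face $F$ has rank $n-\dim F$ and $\Gamma$ is the initial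 element. *)

(* Defs.v *)
From HB Require Import structures.
From mathcomp Require Import all_boot all_order all_algebra.
From mathcomp Require Import boolp mpoly.

Set Implicit Arguments.
Unset Strict Implicit.
Unset Printing Implicit Defensive.

Import Order.TTheory GRing.Theory.

Local Open Scope ring_scope.
Local Open Scope quotient_scope.

Section IdealGen.
Variables (R : comNzRingType) (J : finType) (g : J -> R).

Definition ideal_gen : pred R :=
  fun x => `[< exists c : J -> R, x = \sum_j c j * g j >].

Lemma ideal_gen_closed (S : nzRingType) (eps : {rmorphism R -> S}) :
  (forall j, eps (g j) = 0) -> idealr_closed ideal_gen.
Proof.
move=> eps0; split.
- by apply/asboolP; exists (fun=> 0); rewrite big1 // => j _; rewrite mul0r.
- apply/negP => /asboolP[c /(congr1 eps)]; rewrite rmorph1 rmorph_sum big1.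
    by apply/eqP; rewrite oner_eq0.
  by move=> j _; rewrite rmorphM eps0 mulr0.
- move=> a _ _ /asboolP[c ->] /asboolP[c' ->]; apply/asboolP.
  exists (fun j => a * c j + c' j).
  rewrite mulr_sumr -big_split; apply: eq_bigr => j _ /=.
  by rewrite mulrDl mulrA.
Qed.

End IdealGen.

Section WeightedDegree.
Variables (m : nat) (w : 'I_m -> nat).

Definition wdeg (mon : 'X_{1..m}) : nat := (\sum_(i < m) mon i * w i)%N.

Fact wdeg0 : wdeg 0%MM = 0%N.
Proof. by rewrite /wdeg big1 // => i _; rewrite mnm0E mul0n. Qed.

Fact wdegD : {morph wdeg : m1 m2 / (m1 + m2)%MM >-> (m1 + m2)%N}.
Proof.
move=> m1 m2; rewrite /wdeg -big_split; apply: eq_bigr => i _ /=.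
by rewrite mnmDE mulnDl.
Qed.

HB.instance Definition _ := isMeasure.Build m wdeg wdeg0 wdegD.

End WeightedDegree.

(* A grading is given by the predicates "x is homogeneous of degree d". *)
Definition graded_iso (A B : pzRingType) (homA : nat -> A -> Prop)
    (homB : nat -> B -> Prop) (phi : A -> B) : Prop :=
  bijective phi /\ forall d x, homA d x <-> homB d (phi x).

Definition quot_homog (k : comNzRingType) (m : nat) (w : 'I_m -> nat)
    (I : idealr {mpoly k[m]}) (d : nat) (x : {ideal_quot I}) : Prop :=
  exists2 p : {mpoly k[m]}, p \is d.-homog for (wdeg w) & \pi p = x.

Section FaceRing.
Variables (disp : Order.disp_t) (P : finBPOrderType disp).
Implicit Types s t u v : P.

(* [\bot, s] is isomorphic to the boolean lattice of subsets of 'I_k; since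
   then 2 ^ k <= #|P|, such a k is smaller than #|P|, and it is unique. *)
Definition boolean_below s (k : nat) : bool :=
  [exists f : {ffun {set 'I_k} -> P},
     [forall A, forall B, (f A <= f B)%O == (A \subset B)]
  && [forall t, (t <= s)%O == (t \in codom f)]].

Definition simplicial : Prop := forall s, exists k, boolean_below s k.

Definition rk s : nat :=
  if [pick k : 'I_#|P| | boolean_below s k] is Some k then k else 0%N.

Definition mub s t : {set P} :=
  [set u | [&& (s <= u)%O, (t <= u)%O &
     [forall v, [&& (s <= v)%O, (t <= v)%O & (v <= u)%O] ==> (v == u)]]].

(* The default value \bot is only used when s and t have no greatest common
   lower bound, which in a simplicial poset implies mub s t = set0. *)
Definition glb s t : P :=
  odflt \bot%O [pick u | [&& (u <= s)%O, (u <= t)%O &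
     [forall v, (v <= s)%O && (v <= t)%O ==> (v <= u)%O]]].

Definition nonbot := {s : P | s != \bot%O}.

Variable k : comNzRingType.

Definition vpoly := {mpoly k[#|{: nonbot}|]}.

Definition vgen s : vpoly :=
  if insub s is Some x then 'X_(enum_rank (x : nonbot)) else 1.

Definition vwt (i : 'I_#|{: nonbot}|) : nat := (2 * rk (val (enum_val i)))%N.

Definition face_rel (st : P * P) : vpoly :=
  vgen st.1 * vgen st.2
  - vgen (glb st.1 st.2) * \sum_(u in mub st.1 st.2) vgen u.

Definition face_ideal : pred vpoly := ideal_gen face_rel.

(* Evaluation at v_s = 0, used to see that the ideals below are proper. *)
Local Notation aug := (@meval _ k (fun=> 0)).

Lemma aug_vgen s : aug (vgen s) = (s == \bot%O)%:R.
Proof.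
rewrite /vgen; case: insubP => [x xP _|]; first by rewrite mevalXU (negPf xP).
by rewrite negbK => ->; rewrite rmorph1.
Qed.

Lemma aug_rel s t u (A : pred P) :
    (s = \bot%O -> t = \bot%O -> u = \bot%O /\ A =1 pred1 \bot%O) ->
    (A \bot%O -> s = \bot%O /\ t = \bot%O) ->
  aug (vgen s * vgen t - vgen u * \sum_(v | A v) vgen v) = 0.
Proof.
move=> bot2 Abot; rewrite rmorphB !rmorphM rmorph_sum /=.
under eq_bigr do rewrite aug_vgen.
rewrite !aug_vgen.
have [/andP[/eqP s0 /eqP t0]|st0] := boolP ((s == \bot%O) && (t == \bot%O)).
  have [-> A1] := bot2 s0 t0.
  by rewrite s0 t0 (big_pred1 \bot%O) // eqxx !mulr1 subrr.
rewrite big1 ?mulr0 ?subr0 => [|v Av]; first by rewrite -natrM mulnb (negPf st0).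
case: eqP Av => // -> /Abot[s0 t0].
by rewrite s0 t0 eqxx in st0.
Qed.

Lemma aug_face_rel st : aug (face_rel st) = 0.
Proof.
case: st => s t; apply: aug_rel => /= [-> ->|]; last first.
  by rewrite inE => /and3P[]; rewrite !lex0 => /eqP-> /eqP->.
split; first by rewrite /glb; case: pickP => //= u /and3P[]; rewrite lex0 => /eqP->.
move=> u /=; rewrite !inE; apply/idP/eqP => [/and3P[_ _ /forallP]|->].
  by move/(_ \bot%O); rewrite !le0x /= => /eqP.
by rewrite lexx /=; apply/forallP => v; rewrite !le0x /= lex0 implybb.
Qed.

HB.instance Definition _ := isIdealr.Build vpoly face_ideal
  (ideal_gen_closed (eps := aug) aug_face_rel).

Definition face_ring := {ideal_quot (face_ideal : idealr vpoly)}.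
HB.instance Definition _ := GRing.ComNzRing.on face_ring.

Definition face_ring_homog (d : nat) (x : face_ring) : Prop := quot_homog vwt d x.

End FaceRing.

(* [edge] is the set of oriented edges and [erev] reverses orientation. *)
Record graph := Graph {
  vert : finType;
  edge : finType;
  src : edge -> vert;
  erev : edge -> edge;
  erevK : involutive erev;
  no_loop : forall e, src e != src (erev e)
}.

Section Graphs.
Variable G : graph.
Implicit Types (p q : vert G) (e : edge G).

Definition tgt e : vert G := src (erev e).

Definition star p : {set edge G} := [set e | src e == p].

Definition subgraph : Type := ({set vert G} * {set edge G})%type.
Implicit Types F : subgraph.

Definition is_subgraph F : bool :=
  [forall e in F.2, (src e \in F.1) && (erev e \in F.2)].

Definition adj F : rel (vert G) :=
  fun p q => [exists e in F.2, (src e == p) && (tgt e == q)].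

Definition is_connected F : bool :=
  (F.1 != set0) && [forall p in F.1, forall q in F.1, connect (adj F) p q].

Definition star_in F p : {set edge G} := star p :&: F.2.

Definition is_regular F (k : nat) : bool := [forall p in F.1, #|star_in F p| == k].

Definition full : subgraph := (setT, setT).

Definition sub_leq F F' : bool := (F.1 \subset F'.1) && (F.2 \subset F'.2).

Definition inter F F' : subgraph := (F.1 :&: F'.1, F.2 :&: F'.2).

Definition component F p : subgraph :=
  ([set q in F.1 | connect (adj F) p q],
   [set e in F.2 | connect (adj F) p (src e)]).

Definition components F : {set subgraph} := [set component F p | p in F.1].

End Graphs.

(* H^2(BT) is identified with 'rV[int]_n, and H^*(BT) with {mpoly int[n]}, in
   which the class x of H^2(BT) is the linear form [linform x]. *)
Notation HBT n := {mpoly int[n]}.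

Definition linform (n : nat) (x : 'rV[int]_n) : HBT n := \sum_(j < n) x 0 j *: 'X_j.

Definition HBT_homog (n d : nat) (f : HBT n) : bool :=
  f \is d.-homog for (wdeg (fun=> 2%N)).

Definition is_Zbasis (n : nat) (E : finType) (A : {set E}) (a : E -> 'rV[int]_n) :=
     (forall x : 'rV[int]_n, exists c : E -> int, x = \sum_(e in A) c e *: a e)
  /\ (forall c : E -> int, \sum_(e in A) c e *: a e = 0 -> {in A, forall e, c e = 0}).

(* Only the values [theta e e'] with [src e' = src e] are meaningful. For such
   e', [theta_star] and [theta_rev], applied to e and to [erev e], say that
   [theta e] and [theta (erev e)] are mutually inverse bijections between
   [star (src e)] and [star (tgt e)]. *)
Record torus_graph (n : nat) := TorusGraph {
  tgraph :> graph;
  tg_connected : is_connected (full tgraph);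
  tg_regular : is_regular (full tgraph) n;
  theta : edge tgraph -> edge tgraph -> edge tgraph;
  theta_star : forall e e', src e' = src e -> src (theta e e') = tgt e;
  theta_rev : forall e e', src e' = src e -> theta (erev e) (theta e e') = e';
  theta_self : forall e, theta e e = erev e;
  alpha : edge tgraph -> 'rV[int]_n;
  alpha_rev : forall e, alpha (erev e) = alpha e \/ alpha (erev e) = - alpha e;
  alpha_basis : forall p, is_Zbasis (star p) alpha;
  alpha_theta : forall e e', src e' = src e ->
    exists c : int, alpha (theta e e') - alpha e' = c *: alpha e
}.

Section TorusGraph.
Variables (n : nat) (G : torus_graph n).
Implicit Types (p q : vert G) (e : edge G).

Definition eqcoh_pred : pred {ffun vert G -> HBT n} :=
  fun f => `[< forall e, exists h : HBT n,
                 f (src e) - f (tgt e) = h * linform (alpha e) >].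

Fact eqcoh_subring : subring_closed eqcoh_pred.
Proof.
split.
- by apply/asboolP => e; exists 0; rewrite !ffunE subrr mul0r.
- move=> f g /asboolP Hf /asboolP Hg; apply/asboolP => e.
  have [h hE] := Hf e; have [h' hE'] := Hg e; exists (h - h').
  by rewrite mulrBl -hE -hE' !ffunE !opprD addrACA.
- move=> f g /asboolP Hf /asboolP Hg; apply/asboolP => e.
  have [h hE] := Hf e; have [h' hE'] := Hg e.
  exists (h * g (src e) + f (tgt e) * h').
  rewrite mulrDl mulrAC -hE -mulrA -hE' !ffunE mulrBl mulrBr.
  by rewrite addrA subrK.
Qed.

HB.instance Definition _ :=
  GRing.isSubringClosed.Build {ffun vert G -> HBT n} eqcoh_pred eqcoh_subring.

Record eqcoh := EqCoh { eqcoh_val :> {ffun vert G -> HBT n}; _ : eqcoh_val \in eqcoh_pred }.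

HB.instance Definition _ := [isSub for eqcoh_val].
HB.instance Definition _ := [Choice of eqcoh by <:].
HB.instance Definition _ := GRing.SubChoice_isSubPzRing.Build _ eqcoh_pred eqcoh eqcoh_subring.

Definition eqcoh_homog (d : nat) (f : eqcoh) : Prop := forall p, HBT_homog d (val f p).

Definition is_invariant (F : subgraph G) : bool :=
  [forall e in F.2, forall e' in star_in F (src e), theta e e' \in star_in F (tgt e)].

Definition is_kface (k : nat) (F : subgraph G) : bool :=
  [&& is_subgraph F, is_connected F, is_regular F k & is_invariant F].

Definition is_face (F : subgraph G) : bool := [exists k : 'I_n.+1, is_kface k F].

Record face := Face { face_val :> subgraph G; _ : is_face face_val }.

HB.instance Definition _ := [isSub for face_val].
HB.instance Definition _ := [Finite of face by <:].

Definition dim (F : face) : nat :=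
  if [pick k : 'I_n.+1 | is_kface k F] is Some k then k else 0%N.

Fact full_is_face : is_face (full G).
Proof.
apply/existsP; exists ord_max; rewrite /is_kface tg_connected tg_regular /=.
apply/andP; split; first by apply/forall_inP => e _; rewrite !inE.
apply/forall_inP => e _; apply/forall_inP => e'.
by rewrite /star_in !setIT !inE => /eqP /theta_star ->.
Qed.

Definition face_full : face := Face full_is_face.

(* The faces are ordered by reversed inclusion. *)
Definition face_le (F F' : face) : bool := sub_leq F' F.

Fact face_le_refl : reflexive face_le.
Proof. by move=> F; rewrite /face_le /sub_leq !subxx. Qed.

Fact face_le_anti : antisymmetric face_le.
Proof.
move=> F F' /andP[/andP[a b] /andP[c d]]; apply/val_inj => /=.
case: (face_val F) (face_val F') a b c d => [W S] [W' S'] /= a b c d.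
by congr pair; apply/eqP; rewrite eqEsubset ?a ?b ?c ?d.
Qed.

Fact face_le_trans : transitive face_le.
Proof.
move=> F2 F1 F3 /andP[a b] /andP[c d].
by apply/andP; split; [apply: subset_trans c a | apply: subset_trans d b].
Qed.

Fact face_le_full (F : face) : face_le face_full F.
Proof. by rewrite /face_le /sub_leq !subsetT. Qed.

End TorusGraph.

Fact face_display : Order.disp_t. Proof. exact: Order.Disp tt tt. Qed.

HB.instance Definition _ n (G : torus_graph n) := Order.Le_isPOrder.Build
  face_display (face G) (@face_le_refl n G) (@face_le_anti n G) (@face_le_trans n G).
HB.instance Definition _ n (G : torus_graph n) :=
  Order.hasBottom.Build face_display (face G) (@face_le_full n G).

Section FacesSimplicial.
Variables (n : nat) (G : torus_graph n).
Implicit Types (p q : vert G) (e : edge G) (F : subgraph G) (K L : face G).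

Lemma tgt_rev e : tgt (erev e) = src e.
Proof. by rewrite /tgt erevK. Qed.

Lemma sub_rev F e : is_subgraph F -> e \in F.2 -> erev e \in F.2.
Proof. by move=> /forall_inP sF /sF /andP[]. Qed.

Lemma sub_src F e : is_subgraph F -> e \in F.2 -> src e \in F.1.
Proof. by move=> /forall_inP sF /sF /andP[]. Qed.

Lemma inv_theta F e e' : is_invariant F -> e \in F.2 ->
  e' \in star_in F (src e) -> theta e e' \in star_in F (tgt e).
Proof. by move=> /forall_inP iF /iF /forall_inP; apply. Qed.

Lemma theta_K e e' : src e' = tgt e -> theta e (theta (erev e) e') = e'.
Proof. by move=> h; rewrite -{1}[e]erevK theta_rev. Qed.

Lemma theta_inj e : {in star (src e) &, injective (theta e)}.
Proof.
move=> x y; rewrite !inE => /eqP xe /eqP ye E.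
by rewrite -(theta_rev xe) E theta_rev.
Qed.

Lemma star_in_theta F e : is_subgraph F -> is_invariant F -> e \in F.2 ->
  star_in F (tgt e) = [set theta e e' | e' in star_in F (src e)].
Proof.
move=> sF iF eF; apply/setP => x; apply/idP/imsetP => [xF|[e' e'F ->]]; last first.
  exact: inv_theta.
exists (theta (erev e) x); last by rewrite theta_K //; move: xF; rewrite !inE => /andP[/eqP].
have := inv_theta (e := erev e) (e' := x) iF (sub_rev sF eF).
by rewrite tgt_rev; apply.
Qed.

Lemma card_star_in_theta F e : is_subgraph F -> is_invariant F -> e \in F.2 ->
  #|star_in F (tgt e)| = #|star_in F (src e)|.
Proof.
move=> sF iF eF; rewrite star_in_theta // card_in_imset // => x y.
by rewrite !inE => /andP[xe _] /andP[ye _]; apply: theta_inj; rewrite inE.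
Qed.

Lemma connect_adj_ind F (Q : vert G -> Prop) p q :
    (forall e, e \in F.2 -> Q (src e) -> Q (tgt e)) ->
  connect (adj F) p q -> Q p -> Q q.
Proof.
move=> step /connectP[s sP ->]; elim: s p sP => [|r s IH] p //= /andP[pr sP] Qp.
apply: IH sP _; move: pr => /existsP[e /and3P[eF /eqP pE /eqP <-]].
by apply: step; rewrite ?pE.
Qed.

Lemma adj_sym F : is_subgraph F -> connect_sym (adj F).
Proof.
move=> sF; apply: sym_connect_sym => p q; apply/existsP/existsP.
all: move=> [e /and3P[eF /eqP <- /eqP <-]].
all: by exists (erev e); rewrite tgt_rev (sub_rev sF eF) !eqxx.
Qed.

Lemma connect_edge F e : e \in F.2 -> connect (adj F) (src e) (tgt e).
Proof. by move=> eF; apply/connect1/existsP; exists e; rewrite eF !eqxx. Qed.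

Lemma component_kface F p : is_subgraph F -> is_invariant F -> p \in F.1 ->
  is_kface #|star_in F p| (component F p).
Proof.
move=> sF iF pF.
have compE e : e \in (component F p).2 =
    (e \in F.2) && connect (adj F) p (src e) by rewrite inE.
have compV q : q \in (component F p).1 =
    (q \in F.1) && connect (adj F) p q by rewrite inE.
have sC : is_subgraph (component F p).
  apply/forall_inP => e; rewrite !compE compV => /andP[eF pe].
  by rewrite pe (sub_src sF eF) (sub_rev sF eF) (connect_trans pe (connect_edge eF)).
have stC q : connect (adj F) p q -> star_in (component F p) q = star_in F q.
  move=> pq; apply/setP => e; rewrite !(inE, compE).
  by case: eqP => //= ->; rewrite pq andbT.
apply/and4P; split => //.
- apply/andP; split.
    by apply/set0Pn; exists p; rewrite compV pF connect0.
  have pC q : connect (adj F) p q -> connect (adj (component F p)) p q.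
    move=> pq; have [] // : connect (adj F) p q /\ connect (adj (component F p)) p q.
    apply: (connect_adj_ind (Q := fun r => connect (adj F) p r /\
        connect (adj (component F p)) p r) _ pq) => [e eF [pe pCe]|]; last first.
      by rewrite !connect0.
    split; first exact: connect_trans pe (connect_edge eF).
    by apply: connect_trans pCe (connect_edge _); rewrite compE eF.
  apply/forall_inP => q; rewrite compV => /andP[_ /pC pq].
  apply/forall_inP => r; rewrite compV => /andP[_ /pC]; apply: connect_trans.
  by rewrite adj_sym.
- apply/forall_inP => q; rewrite compV => /andP[_ pq]; rewrite stC //; apply/eqP.
  apply: (connect_adj_ind (Q := fun r => #|star_in F r| = #|star_in F p|) _ pq) => // e eF <-.
  exact: card_star_in_theta.
- apply/forall_inP => e; rewrite compE => /andP[eF pe].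
  apply/forall_inP => e'; rewrite !stC //; last first.
    exact: connect_trans pe (connect_edge eF).
  exact: inv_theta.
Qed.

Lemma component_face F p : is_subgraph F -> is_invariant F -> p \in F.1 ->
  is_face (component F p).
Proof.
move=> sF iF pF.
have le_n : (#|star_in F p| < n.+1)%N.
  rewrite ltnS (leq_trans (subset_leq_card (subsetIl _ _))) //.
  have /forall_inP/(_ p (in_setT _)) := tg_regular G.
  by rewrite /star_in setIT => /eqP ->.
by apply/existsP; exists (Ordinal le_n); apply: component_kface.
Qed.

Lemma faceP K : exists k, is_kface k (face_val K).
Proof. by case: K => K /= /existsP[k kK]; exists k. Qed.

Lemma components_faces K L F : F \in components (inter K L) -> is_face F.
Proof.
have [[k /and4P[sK _ _ iK]] [l /and4P[sL _ _ iL]]] := (faceP K, faceP L).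
have stI p : star_in (inter K L) p = star_in K p :&: star_in L p.
  by rewrite /star_in /= setIIr.
move=> /imsetP[p pKL ->]; apply: component_face => //.
  apply/forall_inP => e; rewrite !inE => /andP[eK eL].
  by rewrite !sub_src // !sub_rev.
apply/forall_inP => e; rewrite inE => /andP[eK eL].
apply/forall_inP => e'; rewrite !stI => /setIP[e'K e'L].
by apply/setIP; split; apply: inv_theta.
Qed.

Lemma face_le_star K L p : p \in (face_val K).1 -> p \in (face_val L).1 ->
  sub_leq L K = (star_in L p \subset star_in K p).
Proof.
have [[k /and4P[sK _ _ iK]] [l /and4P[sL cL _ iL]]] := (faceP K, faceP L).
move=> pK pL; apply/idP/idP => [/andP[_]|sub]; first exact: setIS.
have H q : q \in (face_val L).1 -> q \in (face_val K).1 /\ star_in L q \subset star_in K q.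
  move=> qL; have /andP[_ /forall_inP/(_ p pL)/forall_inP/(_ q qL) pq] := cL.
  apply: (connect_adj_ind (Q := fun r => r \in (face_val K).1 /\ star_in L r \subset star_in K r)
    _ pq) => // e eL [_ sub_e].
  have eK : e \in (face_val K).2.
    have /(subsetP sub_e) : e \in star_in L (src e) by rewrite !inE eqxx.
    by rewrite inE => /andP[].
  split; first exact: sub_src (sub_rev sK eK).
  by rewrite !star_in_theta //; apply: imsetS.
apply/andP; split; apply/subsetP; first by move=> q /H[].
move=> e eL.
have [_ /subsetP/(_ e)] := H _ (sub_src sL eL).
by rewrite !inE eqxx eL => /(_ isT).
Qed.

Lemma face_spanned p (S : {set edge G}) : S \subset star p ->
  exists K : face G, (p \in (face_val K).1) && (star_in K p == S).
Proof.
move=> Sp.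
pose span x := exists c : edge G -> int, x = \sum_(e in S) c e *: alpha e.
have spanD a x y : span x -> span y -> span (a *: x + y).
  move=> [c ->] [c' ->]; exists (fun e => a * c e + c' e).
  rewrite scaler_sumr -big_split; apply: eq_bigr => e _ /=.
  by rewrite scalerDl scalerA.
pose F : subgraph G := (setT, [set e | `[< span (alpha e) >]]).
have memF e : (e \in F.2) = `[< span (alpha e) >] by rewrite inE.
have span0 : span 0 by exists (fun=> 0); rewrite big1 // => e _; rewrite scale0r.
have sF : is_subgraph F.
  apply/forall_inP => e; rewrite !memF in_setT /= => /asboolP se; apply/asboolP.
  case: (alpha_rev e) => ->//; rewrite -[- _]addr0 -scaleN1r; exact: spanD.
have iF : is_invariant F.
  apply/forall_inP => e; rewrite memF => /asboolP se; apply/forall_inP => e'.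
  rewrite !inE => /andP[/eqP e'e /asboolP se']; rewrite theta_star // eqxx /=.
  apply/asboolP; have [c /eqP] := alpha_theta e'e; rewrite subr_eq => /eqP ->.
  exact: spanD.
exists (Face (component_face (p := p) sF iF (in_setT _))).
rewrite /= !inE connect0 /=; apply/eqP/setP => e; rewrite !inE.
have [ep|] /= := eqVneq (src e) p; last first.
  by move=> ep; apply/esym/negP => /(subsetP Sp); rewrite inE (negPf ep).
rewrite ep connect0 andbT; apply/asboolP/idP => [[c cE]|eS]; last first.
  exists (fun e' => (e' == e)%:R); rewrite (bigD1 e) //= eqxx scale1r.
  by rewrite big1 ?addr0 // => e' /andP[_ /negPf ->]; rewrite scale0r.
apply/negPn/negP => eNS; have [_ indep] := alpha_basis p.
have eT : e \in star p by rewrite inE ep.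
pose c' e' : int := (e' == e)%:R - (if e' \in S then c e' else 0).
suff /indep/(_ e eT)/eqP : \sum_(e' in star p) c' e' *: alpha e' = 0.
  by rewrite /c' eqxx (negPf eNS) subr0 oner_eq0.
under eq_bigr do rewrite scalerBl.
rewrite sumrB (bigD1 e) //= eqxx scale1r big1 => [|e' /andP[_ /negPf ->]]; last first.
  by rewrite scale0r.
rewrite addr0 cE; apply/eqP; rewrite subr_eq0; apply/eqP.
rewrite [RHS](big_setID S) /= (setIidPr Sp) [X in _ + X]big1 ?addr0.
  by apply: eq_bigr => e' ->.
by move=> e'; rewrite inE => /andP[/negPf -> _]; rewrite scale0r.
Qed.

Lemma boolean_below_face K :
  exists2 p, p \in (face_val K).1 & boolean_below K #|star p :\: (face_val K).2|.
Proof.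
have [k /and4P[sK /andP[/set0Pn[p pK] _] _ iK]] := faceP K; exists p => //.
set A := star p :\: _.
pose im (B : {set 'I_#|A|}) := [set enum_val i | i in B].
have imA B : im B \subset A by apply/subsetP => _ /imsetP[i _ ->]; apply: enum_valP.
have ex B := face_spanned (subsetDl (star p) (im B)).
pose f := [ffun B => xchoose (ex B)].
have fV B : p \in (face_val (f B)).1 by rewrite ffunE; have /andP[] := xchooseP (ex B).
have fS B : star_in (f B) p = star p :\: im B.
  by rewrite ffunE; have /andP[_ /eqP] := xchooseP (ex B).
apply/existsP; exists f; apply/andP; split.
  apply/forallP => B; apply/forallP => C; apply/eqP.
  rewrite [LHS](face_le_star (fV B) (fV C)) !fS.
  apply/idP/idP => [/subsetP sub|BC]; last by rewrite setDS // imsetS.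
  apply/subsetP => i iB; apply/negPn/negP => iC.
  have iA : enum_val i \in A by apply: enum_valP.
  have /sub : enum_val i \in star p :\: im C.
    rewrite inE (subsetP (subsetDl _ _) _ iA) andbT; apply/negP.
    by move=> /imsetP[j jC /enum_val_inj ij]; rewrite ij jC in iC.
  by rewrite inE => /andP[/negP[]]; apply: imset_f.
apply/forallP => L; apply/eqP; apply/idP/codomP => [LK|[B ->]]; last first.
  change (is_true (sub_leq K (f B))).
  rewrite (face_le_star (fV B) pK) fS; apply/subsetP => e.
  rewrite !inE => /andP[-> eK]; rewrite andbT; apply/negP => /(subsetP (imA B)).
  by rewrite !inE eK.
have /andP[/subsetP KL1 /subsetP KL2] : sub_leq K L := LK.
have pL : p \in (face_val L).1 by apply: KL1.
pose B := [set i : 'I_#|A| | enum_val i \notin (face_val L).2].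
have fL : star_in (f B) p = star_in L p.
  rewrite fS; apply/setP => e; rewrite [LHS]inE [RHS]inE andbC.
  have [ep|//] := boolP (e \in star p); rewrite /=.
  apply/idP/idP => [|eL]; last first.
    by apply/negP => /imsetP[i]; rewrite inE => iL ei; rewrite -ei eL in iL.
  apply: contraNT => eL.
  have eA : e \in A.
    by rewrite inE ep andbT; apply: contraNN eL => /KL2.
  by apply/imsetP; exists (enum_rank_in eA e); rewrite ?inE enum_rankK_in.
exists B; apply/eqP; rewrite eq_le; apply/andP; split.
  by change (is_true (sub_leq (f B) L)); rewrite (face_le_star pL (fV B)) fL.
by change (is_true (sub_leq L (f B))); rewrite (face_le_star (fV B) pL) fL.
Qed.

Lemma face_simplicial : simplicial (face G).
Proof. by move=> K; have [p _ ?] := boolean_below_face K; eexists; eassumption. Qed.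

End FacesSimplicial.

Section ThomRing.
Variables (n : nat) (G : torus_graph n).
Implicit Types F H K : face G.

Definition thom F : {ffun vert G -> HBT n} :=
  [ffun p => if p \in (face_val F).1
             then \prod_(e in star p | e \notin (face_val F).2) linform (alpha e)
             else 0].

(* The minimal face containing F and H, which is unique if F and H meet. *)
Definition fjoin F H : face G :=
  odflt (face_full G) [pick K : face G | [&& sub_leq F K, sub_leq H K &
    [forall K' : face G,
       [&& sub_leq F K', sub_leq H K' & sub_leq K' K] ==> (K' == K)]]].

(* v_F, one variable for each proper face, and v_G = 1 *)
Definition fvar F : vpoly (face G) int := vgen int F.

Definition fwt (i : 'I_#|{: nonbot (face G)}|) : nat :=
  (2 * (n - dim (val (enum_val i))))%N.

(* The sum is over all the components, which are faces by [components_faces];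
   it is empty, hence 0, if F and H do not meet. *)
Definition thom_rel (FH : face G * face G) : vpoly (face G) int :=
  fvar FH.1 * fvar FH.2
  - fvar (fjoin FH.1 FH.2)
    * \sum_(K : face G | face_val K \in components (inter FH.1 FH.2)) fvar K.

Definition thom_ideal : pred (vpoly (face G) int) := ideal_gen thom_rel.

Local Notation aug := (@meval _ int (fun=> 0)).

Lemma component_full p : component (full G) p = full G.
Proof.
have /andP[_ /forall_inP con] := tg_connected G.
rewrite /component /full; congr pair; apply/setP => x; rewrite !inE /=;
  by apply: (forall_inP (con p _)); rewrite inE.
Qed.

Lemma aug_thom_rel FH : aug (thom_rel FH) = 0.
Proof.
case: FH => F H; apply: aug_rel => /= [-> ->|].
  split.
    rewrite /fjoin; case: pickP => //= K /and3P[le_K _ _].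
    by apply/eqP; rewrite -lex0.
  have interE : inter (full G) (full G) = full G by rewrite /inter !setIid.
  move=> K; rewrite /= interE; apply/imsetP/eqP => [[p _]|->].
    by rewrite component_full => E; apply/val_inj.
  have /andP[/set0Pn[p pG] _] := tg_connected G.
  by exists p; rewrite ?component_full.
move=> /imsetP[p _ [VE EE]].
suff bot : forall L : face G, sub_leq (full G) L -> L = \bot%O.
  have [inF inH] : sub_leq (full G) F /\ sub_leq (full G) H.
    by split; apply/andP; split; apply/subsetP => x _;
      have := in_setT x; rewrite ?VE ?EE !inE => /andP[/andP[]].
  by split; apply: bot.
by move=> L le_L; apply/eqP; rewrite -lex0.
Qed.

HB.instance Definition _ := isIdealr.Build (vpoly (face G) int) thom_ideal
  (ideal_gen_closed (eps := aug) aug_thom_rel).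

Definition thom_ring := {ideal_quot (thom_ideal : idealr (vpoly (face G) int))}.
HB.instance Definition _ := GRing.ComNzRing.on thom_ring.

Definition thom_ring_homog (d : nat) (x : thom_ring) : Prop := quot_homog fwt d x.

Definition thom_class F : thom_ring :=
  \pi_{ideal_quot (thom_ideal : idealr (vpoly (face G) int))} (fvar F).

End ThomRing.

(* Main.v *)
(* A facet ("wall") is a face through a vertex p missing exactly one edge e at p.
   The classes alpha(e), e at p, form a basis, so H^*(BT) is at each vertex p the
   polynomial ring Z[v_A : A facet through p]; call psi_p this identification.
   For a face F containing p, composing psi_p with v_A = 0 for the facets A not
   containing F gives rho_F : H^*(BT) -> Z[v_A : A containing F].  It kills alpha(e)
   for e in F and, because of the connection, it does not depend on p, so that
   f |-> rho_F(f(p)) is a well-defined ring morphism on H_T^*.  It sends tau_K to 0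
   unless F lies in K, and tau_F to the product of the v_A, A containing F.

   The relations reduce every element of the face ring to a sum of v_F g_F, with
   g_F in Z[v_A : A containing F].  If such a sum vanishes in H_T^*, then applying
   the rho_F, from the large faces to the small ones, gives g_F = 0 for every F.
   Conversely, if rho_K(f) = 0 for all K strictly containing F, then rho_F(f) is
   divisible by each v_A, A containing F, hence by their product, and subtracting a
   suitable tau_F g_F makes rho_F(f) vanish too; when all rho_F(f) vanish, f = 0. *)

Require Import Defs.
From HB Require Import structures.
From mathcomp Require Import all_boot all_order all_algebra.
From mathcomp Require Import boolp mpoly.

Set Implicit Arguments.
Unset Strict Implicit.
Unset Printing Implicit Defensive.

Import Order.TTheory GRing.Theory.

Local Open Scope ring_scope.
Local Open Scope quotient_scope.

(** * Ring morphisms on integer polynomial rings *)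

Section IntPolynomials.
Variables (m k : nat).

(** Integer coefficients are multiples of 1, so every ring morphism respects them without being
    assumed linear. *)
Lemma rmorph_mpoly_eq (S : pzRingType) (f g : {rmorphism {mpoly int[m]} -> S}) :
  (forall i, f 'X_i = g 'X_i) -> f =1 g.
Proof.
move=> fg p; rewrite [p]mpolyE !rmorph_sum; apply: eq_bigr => mon _ /=.
rewrite -[_@_mon]intz scaler_int !rmorphMz; congr (_ *~ _).
rewrite mpolyXE_id !rmorph_prod; apply: eq_bigr => i _ /=.
by rewrite !rmorphXn fg.
Qed.

(* Locked, as unification would otherwise try to compute distinct polynomials. *)
Definition msubst (h : 'I_m -> {mpoly int[k]}) : {mpoly int[m]} -> {mpoly int[k]} :=
  locked (mmap (@mpolyC k int) h).

Lemma msubst_sub h : zmod_morphism (msubst h).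
Proof. by rewrite /msubst -lock; apply: rmorphB. Qed.

Lemma msubst_mul h : monoid_morphism (msubst h).
Proof. by rewrite /msubst -lock; split; [apply: rmorph1 | apply: rmorphM]. Qed.

HB.instance Definition _ h :=
  GRing.isZmodMorphism.Build {mpoly int[m]} {mpoly int[k]} (msubst h) (msubst_sub h).
HB.instance Definition _ h :=
  GRing.isMonoidMorphism.Build {mpoly int[m]} {mpoly int[k]} (msubst h) (msubst_mul h).

Lemma msubstX h i : msubst h 'X_i = h i.
Proof. by rewrite /msubst -lock mmapX mmap1U. Qed.

(** Scalars need no clause of their own: each integer is reached from 1 by subtractions. *)
Lemma mpoly_ring_ind (Q : {mpoly int[m]} -> Prop) :
    Q 1 -> (forall p q, Q p -> Q q -> Q (p - q)) ->
    (forall i p, Q p -> Q ('X_i * p)) -> forall p, Q p.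
Proof.
move=> Q1 QB QX p.
have Q0 : Q 0 by rewrite -(subrr 1); apply: QB.
have QN q : Q q -> Q (- q) by rewrite -sub0r; apply: QB.
have QD q r : Q q -> Q r -> Q (q + r).
  by move=> ? /QN ?; rewrite -[r]opprK; apply: QB.
have QX' i j q : Q q -> Q ('X_i ^+ j * q).
  by elim: j => [|j IH]; rewrite ?expr0 ?mul1r // exprS -mulrA => /IH/QX.
rewrite [p]mpolyE; elim/big_ind: _ => // mon _.
have QM : Q 'X_[mon].
  by rewrite mpolyXE_id; elim/big_rec: _ => // i q _; apply: QX'.
rewrite -[_@_mon]intz scaler_int; case: (p@_mon) => c; last rewrite NegzE mulrNz.
  by elim: c => [|c IH]; rewrite ?mulr0z // intS mulrzDr mulr1z; apply: QD.
apply: QN; elim: c => [|c IH]; first by rewrite mulr1z.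
by rewrite intS mulrzDr mulr1z; apply: QD.
Qed.

End IntPolynomials.

(** * Divisibility by variables *)

Section KillVariable.
Variable m : nat.
Implicit Types (i j : 'I_m) (p : {mpoly int[m]}).

Lemma mvar_neq0 i : 'X_i != 0 :> {mpoly int[m]}.
Proof.
by apply/eqP => /(congr1 (mcoeff U_(i)))/eqP; rewrite mcoeffX eqxx mcoeff0.
Qed.

Definition mkill i := msubst (fun j => if j == i then 0 else 'X_j : {mpoly int[m]}).

HB.instance Definition _ i := GRing.RMorphism.on (mkill i).

Lemma mkillX i j : mkill i 'X_j = if j == i then 0 else 'X_j.
Proof. exact: msubstX. Qed.

Lemma mkill_dvd i p : exists q, p - mkill i p = 'X_i * q.
Proof.
elim/mpoly_ring_ind: p => [|p q [p' pE] [q' qE]|j p [p' pE]].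
- by exists 0; rewrite rmorph1 subrr mulr0.
- by exists (p' - q'); rewrite rmorphB /= opprD addrACA -opprD pE qE mulrBr.
- rewrite rmorphM /= mkillX; have [->|_] := eqVneq j i.
    by exists p; rewrite mul0r subr0.
  by exists ('X_j * p'); rewrite -mulrBr pE mulrCA.
Qed.

(** Variables are split off one at a time: killing another variable fixes ['X_i], a nonzero element
    of a domain, so the cofactor is killed too. *)
Lemma dvd_prod_vars (s : seq 'I_m) p : uniq s ->
  (forall i, i \in s -> mkill i p = 0) -> exists q, p = (\prod_(i <- s) 'X_i) * q.
Proof.
elim: s p => [|i s IH] p; first by exists p; rewrite big_nil mul1r.
move=> /= /andP[is_ us] kp.
have [q qE] := mkill_dvd i p.
rewrite kp ?mem_head // subr0 in qE.
have [j js|r rE] := IH q us; last by exists r; rewrite big_cons -mulrA -rE.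
have := kp j; rewrite inE js orbT => /(_ isT).
rewrite qE rmorphM /= mkillX ifN; last first.
  by apply: contraNneq is_ => ->.
by move/eqP; rewrite mulf_eq0 => /orP[|/eqP //]; rewrite (negPf (mvar_neq0 _)).
Qed.

End KillVariable.

(** * Graded isomorphisms out of a quotient *)

Lemma quot_graded_iso (k : comNzRingType) (m : nat) (w : 'I_m -> nat)
    (I : idealr {mpoly k[m]}) (B : pzRingType) (homB : nat -> B -> Prop)
    (f : {rmorphism {mpoly k[m]} -> B}) :
    (forall p, p \in I <-> f p = 0) ->
    (forall b, exists p, f p = b) ->
    (forall d p, p \is d.-homog for (wdeg w) -> homB d (f p)) ->
    (forall d b, homB d b -> exists2 p, p \is d.-homog for (wdeg w) & f p = b) ->
  exists phi : {rmorphism {ideal_quot I} -> B},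
    graded_iso (@quot_homog k m w I) homB phi /\
    forall p, phi (\pi_{ideal_quot I} p) = f p.
Proof.
move=> kerf surjf homf homf'.
pose phi (x : {ideal_quot I}) := f (repr x).
have phi_pi p : phi (\pi p) = f p.
  apply/eqP; rewrite -subr_eq0 -rmorphB; apply/eqP/kerf.
  by rewrite Quotient.idealrBE reprK.
have phi_add : zmod_morphism phi.
  elim/quotW=> p; elim/quotW=> q.
  by rewrite -[in LHS]rmorphB !phi_pi rmorphB.
have phi_mul : monoid_morphism phi.
  split; first by rewrite -(rmorph1 (\pi_{ideal_quot I})) phi_pi rmorph1.
  by elim/quotW=> p; elim/quotW=> q; rewrite -[in LHS]rmorphM !phi_pi rmorphM.
pose isA := GRing.isZmodMorphism.Build {ideal_quot I} B phi phi_add.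
pose isM := GRing.isMonoidMorphism.Build {ideal_quot I} B phi phi_mul.
pose phiM : {rmorphism {ideal_quot I} -> B} := HB.pack phi isA isM.
exists phiM; split; last exact: phi_pi.
have phi_inj : injective phi.
  elim/quotW=> p; elim/quotW=> q; rewrite !phi_pi => /eqP.
  rewrite -subr_eq0 -rmorphB => /eqP/kerf.
  by rewrite Quotient.idealrBE => /eqP.
split.
  pose g b := \pi_{ideal_quot I} (sval (cid (surjf b))).
  have gK : cancel g phi by move=> b; rewrite phi_pi; case: cid.
  by exists g => // x; apply: phi_inj; rewrite gK.
(* Conversely, [phi x] lifts to a homogeneous polynomial, whose class is [x] by injectivity. *)
move=> d x; split=> [[p hp <-]|/homf'[p hp fp]]; first by rewrite /= phi_pi; apply: homf.
by exists p => //; apply: phi_inj; rewrite phi_pi.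
Qed.

(** * Faces and facets of a torus graph *)

Section Faces.
Variables (n : nat) (G : torus_graph n).
Implicit Types (p q : vert G) (e : edge G) (F K L : face G).

Lemma face_edge_src K e : e \in (face_val K).2 -> src e \in (face_val K).1.
Proof. by have [k /and4P[sK _ _ _]] := faceP K; apply: sub_src. Qed.

Lemma face_edge_rev K e : (erev e \in (face_val K).2) = (e \in (face_val K).2).
Proof.
have [k /and4P[sK _ _ _]] := faceP K; apply/idP/idP; last exact: sub_rev.
by rewrite -{2}[e]erevK; apply: sub_rev.
Qed.

Lemma face_edge_tgt K e : e \in (face_val K).2 -> tgt e \in (face_val K).1.
Proof. by rewrite -face_edge_rev => /face_edge_src. Qed.

Lemma face_connected_ind K (Q : vert G -> Prop) p q :
    p \in (face_val K).1 -> q \in (face_val K).1 ->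
    (forall e, e \in (face_val K).2 -> Q (src e) -> Q (tgt e)) -> Q p -> Q q.
Proof.
move=> pK qK step; apply: (connect_adj_ind step).
have [k /and4P[_ /andP[_ /forall_inP cK] _ _]] := faceP K.
by apply: (forall_inP (cK p pK)).
Qed.

Lemma face_theta K e e' : src e' = src e -> e \in (face_val K).2 ->
  (theta e e' \in (face_val K).2) = (e' \in (face_val K).2).
Proof.
move=> se eK; have [k /and4P[_ _ _ iK]] := faceP K.
have H x y : src y = src x -> x \in (face_val K).2 -> y \in (face_val K).2 ->
    theta x y \in (face_val K).2.
  move=> syx xK yK; have := inv_theta (e' := y) iK xK.
  by rewrite !inE syx eqxx yK => /(_ isT) /andP[].
apply/idP/idP => [|e'K]; last exact: H.
rewrite -{2}(theta_rev se); apply: H; last by rewrite face_edge_rev.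
by rewrite theta_star.
Qed.

Lemma face_vert_ex K : exists p, p \in (face_val K).1.
Proof. by have [k /and4P[_ /andP[/set0Pn]]] := faceP K. Qed.

Definition face_vert K := xchoose (face_vert_ex K).

Lemma face_vertP K : face_vert K \in (face_val K).1.
Proof. exact: xchooseP. Qed.

(** The connection transports the star of a face along its edges, so the star at one vertex
    determines the face. *)
Lemma face_eq_star K L p : p \in (face_val K).1 -> p \in (face_val L).1 ->
  star_in K p = star_in L p -> K = L.
Proof.
by move=> pK pL E; apply/face_le_anti; rewrite /face_le !(@face_le_star _ _ _ _ p) // E subxx.
Qed.

Lemma sub_face_vert K L p : sub_leq K L -> p \in (face_val K).1 -> p \in (face_val L).1.
Proof. by case/andP => /subsetP KL _ /KL. Qed.

Lemma sub_face_edge K L e : sub_leq K L -> e \in (face_val K).2 -> e \in (face_val L).2.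
Proof. by case/andP => _ /subsetP KL /KL. Qed.

Lemma sub_faceP K L p : p \in (face_val K).1 -> p \in (face_val L).1 ->
  reflect (forall e, src e = p -> e \in (face_val K).2 -> e \in (face_val L).2)
          (sub_leq K L).
Proof.
move=> pK pL; apply: (iffP idP) => [KL e _|H]; first exact: sub_face_edge.
rewrite (face_le_star pL pK); apply/subsetP => e.
by rewrite !inE => /andP[/eqP ep eK]; rewrite ep eqxx H.
Qed.

(* Locked, lest unification evaluate the enumeration of the faces. *)
Definition face_span := locked (fun p (S : {set edge G}) =>
  xchoose (face_spanned (subsetIl (star p) S)) : face G).

Lemma face_spanV p S : p \in (face_val (face_span p S)).1.
Proof.
by rewrite /face_span; unlock; case/andP: (xchooseP (face_spanned (subsetIl (star p) S))).
Qed.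

Lemma face_spanE p S e : src e = p -> (e \in (face_val (face_span p S)).2) = (e \in S).
Proof.
rewrite /face_span; unlock.
move=> ep; have /andP[_ /eqP/setP/(_ e)] := xchooseP (face_spanned (subsetIl (star p) S)).
by rewrite !inE ep eqxx.
Qed.

(* The facet through [src e] that is transverse to [e]. *)
Definition wall e : face G := face_span (src e) (~: [set e]).

Lemma wallV e : src e \in (face_val (wall e)).1.
Proof. exact: face_spanV. Qed.

Lemma wallE e e' : src e' = src e -> (e' \in (face_val (wall e)).2) = (e' != e).
Proof. by move=> se; rewrite face_spanE // !inE. Qed.

Lemma wall_inj e e' : src e = src e' -> wall e = wall e' -> e = e'.
Proof.
move=> se /(congr1 (fun K => e \in (face_val K).2)).
by rewrite !wallE // eqxx => /esym/negbFE/eqP.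
Qed.

Lemma wall_neq_bot e : wall e != \bot%O.
Proof.
apply: contraTneq (in_setT e) => wb.
by have := wallE (erefl (src e)); rewrite eqxx wb in_setT.
Qed.

Lemma sub_wall F e : src e \in (face_val F).1 ->
  sub_leq F (wall e) = (e \notin (face_val F).2).
Proof.
move=> eF; apply/idP/idP => [FW|eNF].
  by apply: contraT => /negPn /(sub_face_edge FW); rewrite wallE ?eqxx.
apply/(sub_faceP eF (wallV e)) => e' se' e'F; rewrite wallE //.
by apply: contraNneq eNF => <-.
Qed.

(** As [e] lies in [wall e'], the connection along [e] preserves this facet, so it carries the edge
    missing at [src e] to the edge missing at [tgt e]. *)
Lemma wall_theta e e' : src e' = src e -> e' != e -> wall (theta e e') = wall e'.
Proof.
move=> se ne.
have eW : e \in (face_val (wall e')).2 by rewrite wallE // eq_sym.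
have st := theta_star se.
have tW := face_edge_tgt eW.
apply: (face_eq_star (p := tgt e)) => //; first by rewrite -st wallV.
apply/setP => x; rewrite !inE; have [sx|] //= := eqVneq (src x) (tgt e).
rewrite wallE ?st // -{2}[x](theta_K sx).
have sy : src (theta (erev e) x) = src e by rewrite theta_star // tgt_rev.
rewrite face_theta // wallE ?sy //; congr (~~ _).
apply/eqP/eqP => [->|<-]; first by rewrite theta_rev.
by rewrite theta_K.
Qed.

Definition is_wall K := K \in codom wall.

Lemma wall_is_wall e : is_wall (wall e).
Proof. exact: codom_f. Qed.

(** The transverse edge at one vertex is transported by the connection along the facet; it stays
    distinct from the edge followed, which lies in the facet. *)
Lemma is_wallP K p : is_wall K -> p \in (face_val K).1 -> exists2 e, src e = p & K = wall e.
Proof.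
move=> /codomP[e0 KE] pK.
have e0K : src e0 \in (face_val K).1 by rewrite KE wallV.
apply: (face_connected_ind (Q := fun r => exists2 e, src e = r & K = wall e) e0K pK).
  2: by exists e0.
move=> e eK [e' se' KE']; exists (theta e e'); first exact: theta_star.
rewrite wall_theta //; apply: contraTneq eK => <-.
by rewrite KE' wallE ?eqxx.
Qed.

End Faces.

(** * Linear forms and scalars *)

Lemma rmorphZint (m k : nat) (f : {rmorphism {mpoly int[m]} -> {mpoly int[k]}}) c p :
  f (c *: p) = c *: f p.
Proof. by rewrite -[c]intz !scaler_int rmorphMz. Qed.

Section LinForm.
Variable n : nat.

Lemma linform_delta (j : 'I_n) : linform (delta_mx 0 j) = 'X_j.
Proof.
rewrite /linform (bigD1 j) //= mxE !eqxx scale1r big1 ?addr0 // => i /negPf ij.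
by rewrite mxE ij andbF scale0r.
Qed.

Lemma linform_lin a (x y : 'rV[int]_n) :
  linform (a *: x + y) = a *: linform x + linform y.
Proof.
rewrite /linform scaler_sumr -big_split; apply: eq_bigr => j _ /=.
by rewrite !mxE scalerDl scalerA.
Qed.

Lemma linform0 : linform (0 : 'rV[int]_n) = 0.
Proof. by rewrite /linform big1 // => j _; rewrite mxE scale0r. Qed.

Lemma linformZ a (x : 'rV[int]_n) : linform (a *: x) = a *: linform x.
Proof. by rewrite -[a *: x]addr0 linform_lin linform0 addr0. Qed.

Lemma linform_sum (E : finType) (A : {set E}) (c : E -> int) (x : E -> 'rV[int]_n) :
  linform (\sum_(e in A) c e *: x e) = \sum_(e in A) c e *: linform (x e).
Proof.
elim/big_rec2: _ => [|e y z _ <-]; first exact: linform0.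
by rewrite linform_lin.
Qed.

Lemma linform_homog x : HBT_homog 2 (linform x : HBT n).
Proof.
apply: rpred_sum => j _; apply: rpredZ; rewrite dhomogX /= /wdeg.
rewrite (bigD1 j) //= mnm1E eqxx big1 ?addn0 // => i /negPf ij.
by rewrite mnm1E eq_sym ij mul0n.
Qed.

End LinForm.

(** * Face variables and substitutions *)

Section FaceVariables.
Variables (n : nat) (G : torus_graph n).
Implicit Types (p q : vert G) (e : edge G) (F K L : face G).

Local Notation poly := (vpoly (face G) int).

(* Locked, as comparing two face variables by computation diverges. *)
Definition face_var := locked (@fvar n G).

Lemma face_varE F : fvar F = face_var F.
Proof. by rewrite /face_var -lock. Qed.

Lemma face_var_bot : face_var (\bot%O : face G) = 1.
Proof. by rewrite -face_varE /fvar /vgen insubF ?eqxx. Qed.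

Lemma face_var_enum (i : 'I_#|{: nonbot (face G)}|) : face_var (val (enum_val i)) = 'X_i.
Proof. by rewrite -face_varE /fvar /vgen valK enum_valK. Qed.

(** Stated in [Type], so that [restrict_dvd] can turn the index into a function of the edge. *)
Lemma face_var_nonbot F : F != \bot%O -> {i | F = val (enum_val i) & face_var F = 'X_i}.
Proof.
move=> Fb; exists (enum_rank (Sub F Fb : nonbot (face G))); rewrite ?enum_rankK ?SubK //.
by rewrite -face_var_enum enum_rankK SubK.
Qed.

Lemma face_var_neq0 F : face_var F != 0.
Proof.
have [->|/face_var_nonbot[i _ ->]] := eqVneq F \bot%O; last exact: mvar_neq0.
by rewrite face_var_bot oner_neq0.
Qed.

Lemma rmorph_vpoly_eq (S : pzRingType) (f g : {rmorphism poly -> S}) :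
  (forall F, f (face_var F) = g (face_var F)) -> f =1 g.
Proof. by move=> fg; apply: rmorph_mpoly_eq => i; rewrite -face_var_enum. Qed.

Lemma vpoly_ring_ind (Q : poly -> Prop) :
    Q 1 -> (forall x y, Q x -> Q y -> Q (x - y)) ->
    (forall F x, Q x -> Q (face_var F * x)) -> forall x, Q x.
Proof.
move=> Q1 QB QX; apply: mpoly_ring_ind => // i p.
by rewrite -face_var_enum; apply: QX.
Qed.

Definition fsubst (k : nat) (h : face G -> {mpoly int[k]}) : poly -> {mpoly int[k]} :=
  msubst (fun i => h (val (enum_val i))).

HB.instance Definition _ k h := GRing.RMorphism.on (@fsubst k h).

Lemma fsubst_face_var k (h : face G -> {mpoly int[k]}) F :
  h \bot%O = 1 -> fsubst h (face_var F) = h F.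
Proof.
move=> h1; have [->|/face_var_nonbot[i FE ->]] := eqVneq F \bot%O.
  by rewrite face_var_bot rmorph1.
by rewrite /fsubst msubstX FE.
Qed.

Definition thom_eval p := fsubst (fun F => thom F p).

HB.instance Definition _ p := GRing.RMorphism.on (thom_eval p).

Lemma thom_bot p : thom (\bot%O : face G) p = 1.
Proof. by rewrite ffunE in_setT big1 // => e; rewrite in_setT andbF. Qed.

Lemma thom_eval_face_var p F : thom_eval p (face_var F) = thom F p.
Proof. by rewrite /thom_eval fsubst_face_var // thom_bot. Qed.

(** Projection onto the subring Z[v_A : A a facet containing [F]]; elements of this subring are
    written [fkill F x] throughout. The clause for the bottom face only records that its variable is
    1. *)
Definition fkill F := fsubst (fun K =>
  if (K == \bot%O) || (is_wall K && sub_leq F K) then face_var K else 0).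

HB.instance Definition _ F := GRing.RMorphism.on (fkill F).

Lemma fkill_face_var F K : fkill F (face_var K) =
  if (K == \bot%O) || (is_wall K && sub_leq F K) then face_var K else 0.
Proof. by rewrite /fkill fsubst_face_var // eqxx face_var_bot. Qed.

Lemma fkill_wall F e : src e \in (face_val F).1 ->
  fkill F (face_var (wall e)) = if e \in (face_val F).2 then 0 else face_var (wall e).
Proof.
by move=> eF; rewrite fkill_face_var (negPf (wall_neq_bot e)) wall_is_wall sub_wall //= if_neg.
Qed.

Lemma sub_leq_trans F K L : sub_leq F K -> sub_leq K L -> sub_leq F L.
Proof. by move=> FK KL; apply: (face_le_trans KL FK). Qed.

Lemma fkill_sub F K x : sub_leq F K -> fkill F (fkill K x) = fkill K x.
Proof.
move=> FK; apply: (rmorph_vpoly_eq (f := fkill F \o fkill K)) => L /=.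
rewrite fkill_face_var; case: ifP => [|_]; last by rewrite rmorph0.
rewrite fkill_face_var; case: (L == _) => //= /andP[-> KL].
by rewrite (sub_leq_trans FK KL).
Qed.

Lemma face_var_wall e : {i | wall e = val (enum_val i) & face_var (wall e) = 'X_i}.
Proof. exact: face_var_nonbot (wall_neq_bot e). Qed.

End FaceVariables.

(** * Restriction of equivariant classes to faces *)

Section Restriction.
Variables (n : nat) (G : torus_graph n).
Implicit Types (p q : vert G) (e : edge G) (F K L : face G).

Local Notation poly := (vpoly (face G) int).

Lemma alpha_coord p (j : 'I_n) :
  exists c : edge G -> int, delta_mx 0 j = \sum_(e in star p) c e *: alpha e.
Proof. by have [+ _] := alpha_basis p; apply. Qed.

Definition coord p j := sval (cid (alpha_coord p j)).

Lemma coordE p j : delta_mx 0 j = \sum_(e in star p) coord p j e *: alpha e.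
Proof. by rewrite /coord; case: cid. Qed.

Lemma star_rmorph_eq k p (f g : {rmorphism HBT n -> {mpoly int[k]}}) :
    (forall e, src e = p -> f (linform (alpha e)) = g (linform (alpha e))) ->
  f =1 g.
Proof.
move=> fg; apply: rmorph_mpoly_eq => j.
rewrite -linform_delta (coordE p) linform_sum !rmorph_sum; apply: eq_bigr => e.
by rewrite inE !rmorphZint => /eqP ep; rewrite fg.
Qed.

(* The right inverse of [thom_eval p] with values in the polynomials in the
   facets through p. *)
Definition psi p : HBT n -> poly :=
  msubst (fun j => \sum_(e in star p) coord p j e *: face_var (wall e)).

HB.instance Definition _ p := GRing.RMorphism.on (psi p).

(** Rewriting [alpha e] through the standard basis and back gives an expansion in the axial basis,
    whose coefficients linear independence forces to be those of [e] alone. *)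
Lemma psi_alpha e : psi (src e) (linform (alpha e)) = face_var (wall e).
Proof.
set p := src e; set x := alpha e.
pose d e' := \sum_j x 0 j * coord p j e'.
(* The same exchange of sums serves twice: for the axial classes and for the facet variables. *)
have dE (V : lmodType int) (v : edge G -> V) :
    \sum_j x 0 j *: (\sum_(e' in star p) coord p j e' *: v e')
      = \sum_(e' in star p) d e' *: v e'.
  under eq_bigr do rewrite scaler_sumr.
  rewrite exchange_big /=; apply: eq_bigr => e' _.
  by rewrite scaler_suml; apply: eq_bigr => j _; rewrite scalerA.
have ep : e \in star p by rewrite inE.
have dx : \sum_(e' in star p) (d e' - (e' == e)%:R) *: alpha e' = 0.
  under eq_bigr do rewrite scalerBl.
  rewrite sumrB -dE; under eq_bigr do rewrite -coordE.
  rewrite -row_sum_delta (bigD1 e) //= eqxx scale1r big1 ?addr0 ?subrr //.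
  move=> e' /andP[_ /negPf->].
  by rewrite scale0r.
have d1 e' : e' \in star p -> d e' = (e' == e)%:R.
  move=> e'p; apply/eqP; rewrite -subr_eq0; apply/eqP.
  by have [_ /(_ _ dx)] := alpha_basis p; apply.
rewrite {1}/linform rmorph_sum.
under eq_bigr do rewrite rmorphZint /= /psi msubstX.
rewrite dE (bigD1 e) //= d1 // eqxx scale1r big1 ?addr0 // => e' /andP[/d1-> /negPf->].
by rewrite scale0r.
Qed.

Lemma thom_wall e : thom (wall e) (src e) = linform (alpha e).
Proof.
rewrite ffunE wallV (big_pred1 e) // => e'; rewrite inE /=.
have [se|] := eqVneq (src e') (src e); first by rewrite wallE // negbK.
by move=> ne; apply/esym/negP => /eqP E; rewrite E eqxx in ne.
Qed.

(* For p in F this kills the directions tangent to F, and does not depend on p: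
   see [restrictE]. *)
Definition rho F p : HBT n -> poly := fkill F \o psi p.

HB.instance Definition _ F p := GRing.RMorphism.on (rho F p).

Lemma rho_alpha F e : src e \in (face_val F).1 ->
  rho F (src e) (linform (alpha e)) = if e \in (face_val F).2 then 0 else face_var (wall e).
Proof. by move=> eF; rewrite /rho /= psi_alpha fkill_wall. Qed.

(** This is checked on the axial basis at [tgt e]: transport along [e] changes a class by a multiple
    of [alpha e], which [rho F] kills, and off [F] it keeps the wall by [wall_theta]. *)
Lemma rho_edge F e : e \in (face_val F).2 -> rho F (src e) =1 rho F (tgt e).
Proof.
move=> eF; apply: (star_rmorph_eq (p := tgt e)) => x sx.
have [sF tF] := (face_edge_src eF, face_edge_tgt eF).
rewrite -sx /= rho_alpha ?sx //.
have [y sy xE] : exists2 y, src y = src e & x = theta e y.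
  by exists (theta (erev e) x); rewrite ?theta_K // theta_star // tgt_rev.
have [c /eqP] := alpha_theta sy.
rewrite -xE subr_eq => /eqP ->.
rewrite linform_lin rmorphD rmorphZint /= rho_alpha // eF scaler0 add0r.
rewrite -sy rho_alpha; last by rewrite sy.
have -> : (x \in (face_val F).2) = (y \in (face_val F).2).
  by rewrite [in LHS]xE face_theta.
have [//|yF] := boolP (y \in (face_val F).2); rewrite xE.
by rewrite wall_theta //; apply: contraNneq yF => ->.
Qed.

Definition restrict F (f : vert G -> HBT n) := rho F (face_vert F) (f (face_vert F)).

(** Along an edge of [F] the values of [f] differ by a multiple of its axial class, which [rho F]
    kills. *)
Lemma restrictE F p (f : eqcoh G) : p \in (face_val F).1 -> restrict F f = rho F p (f p).
Proof.
move=> pF; rewrite /restrict.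
pose Q r := rho F (face_vert F) (f (face_vert F)) = rho F r (f r).
apply: (face_connected_ind (Q := Q) (face_vertP F) pF); last by [].
rewrite {}/Q => e eF ->.
rewrite -(rho_edge eF); apply/eqP; rewrite -subr_eq0 -rmorphB.
have /asboolP/(_ e)[h ->] := valP f.
by rewrite rmorphM /= rho_alpha ?face_edge_src // eF mulr0.
Qed.

Lemma thomE F p : p \in (face_val F).1 ->
  thom F p = \prod_(e in star p | e \notin (face_val F).2) linform (alpha e).
Proof. by move=> pF; rewrite ffunE pF. Qed.

Lemma rho_thom F p : p \in (face_val F).1 ->
  rho F p (thom F p) = \prod_(e in star p | e \notin (face_val F).2) face_var (wall e).
Proof.
move=> pF; rewrite thomE // rmorph_prod; apply: eq_bigr => e /andP[].
by rewrite inE => /eqP ep /negPf eF; rewrite -ep /= rho_alpha ?ep // eF.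
Qed.

(** An edge at [p] lying in [F] but not in [K] contributes to the Thom class of [K] a factor that
    [rho F p] kills. *)
Lemma rho_thom0 F K p : p \in (face_val F).1 -> ~~ sub_leq F K ->
  rho F p (thom K p) = 0.
Proof.
move=> pF FK; rewrite ffunE; case: ifP => [pK|_]; last exact: rmorph0.
have /existsP[e /and3P[/eqP ep eF eK]] :
    [exists e, [&& src e == p, e \in (face_val F).2 & e \notin (face_val K).2]].
  apply: contraR FK; rewrite negb_exists => /forallP H; apply/(sub_faceP pF pK) => e ep eF.
  by have := H e; rewrite ep eqxx eF /= negbK.
rewrite rmorph_prod (bigD1 e) /=; last by rewrite inE ep eqxx.
by rewrite -ep rho_alpha ?ep // eF mul0r.
Qed.

Lemma dvd_linform_rev (e : edge G) (x : HBT n) :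
  (exists h, x = h * linform (alpha (erev e))) -> exists h, x = h * linform (alpha e).
Proof.
move=> [h ->]; case: (alpha_rev e) => ->; first by exists h.
by exists (- h); rewrite -scaleN1r linformZ scaleN1r mulNr mulrN.
Qed.

Lemma thom_dvd F e : e \notin (face_val F).2 ->
  exists h, thom F (src e) = h * linform (alpha e).
Proof.
move=> eF; rewrite ffunE; case: ifP => _; last by exists 0; rewrite mul0r.
by rewrite (bigD1 e) /= ?inE ?eqxx // mulrC; eexists.
Qed.

(** For [e] outside [F], both end values are multiples of [alpha e]. For [e] in [F], the connection
    matches their factors, which are congruent modulo [alpha e]. *)
Lemma thom_eqcoh F : thom F \in @eqcoh_pred n G.
Proof.
apply/asboolP => e; have [eF|eF] := boolP (e \in (face_val F).2); last first.
  have [h hE] := thom_dvd eF.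
  have [|h' h'E] := @dvd_linform_rev e (thom F (tgt e)).
    by apply: (@thom_dvd F (erev e)); rewrite face_edge_rev.
  by exists (h - h'); rewrite mulrBl hE h'E.
rewrite !thomE ?face_edge_src ?face_edge_tgt ?face_edge_rev //.
have -> : \prod_(x in star (tgt e) | x \notin (face_val F).2) linform (alpha x) =
    \prod_(x in star (src e) | x \notin (face_val F).2) linform (alpha (theta e x)).
  rewrite (reindex_onto (theta e) (theta (erev e))) /=; last first.
    by move=> x /andP[]; rewrite inE => /eqP sx _; rewrite theta_K.
  apply: eq_bigl => x; rewrite !inE; have [sx|nx] := eqVneq (src x) (src e).
    by rewrite theta_star // eqxx face_theta // theta_rev // eqxx andbT.
  apply/negP => /andP[/andP[/eqP st _] /eqP tx].
  by move/eqP: nx; apply; rewrite -tx theta_star // tgt_rev.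
elim/big_rec2: _ => [|x a b /andP[+ _] [h hE]]; first by exists 0; rewrite subrr mul0r.
rewrite inE => /eqP sx; have [c cE] := alpha_theta sx.
have tE : linform (alpha (theta e x)) =
    c%:MP * linform (alpha e) + linform (alpha x) :> HBT n.
  by rewrite mul_mpolyC -linform_lin -cE subrK.
(* With partial products s at [src e] and t transported, s - t = h alpha(e) gives alpha(x) s -
   (alpha(x) + c alpha(e)) t = (alpha(x) h - c t) alpha(e). *)
exists (linform (alpha x) * h - c%:MP * a).
rewrite tE [RHS]mulrBl -[_ * h * _]mulrA -hE mulrBr mulrDl opprD addrA.
by rewrite addrAC [_ * a * _]mulrAC.
Qed.

Definition thom_fun (x : poly) : {ffun vert G -> HBT n} := [ffun p => thom_eval p x].

Lemma thom_fun_sub : zmod_morphism thom_fun.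
Proof. by move=> x y; apply/ffunP => p; rewrite !ffunE rmorphB. Qed.

Lemma thom_fun_mul : monoid_morphism thom_fun.
Proof.
by split=> [|x y]; apply/ffunP => p; rewrite !ffunE ?rmorph1 ?rmorphM.
Qed.

HB.instance Definition _ := GRing.isZmodMorphism.Build _ _ thom_fun thom_fun_sub.
HB.instance Definition _ := GRing.isMonoidMorphism.Build _ _ thom_fun thom_fun_mul.

Lemma thom_fun_eqcoh x : thom_fun x \in @eqcoh_pred n G.
Proof.
elim/vpoly_ring_ind: x => [|x y Qx Qy|F x Qx].
- by rewrite rmorph1 rpred1.
- by rewrite rmorphB rpredB.
have FE : thom_fun (face_var F) = thom F.
  by apply/ffunP => p; rewrite ffunE thom_eval_face_var.
by rewrite rmorphM rpredM //= FE thom_eqcoh.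
Qed.

Definition thom_map (x : poly) : eqcoh G := EqCoh (thom_fun_eqcoh x).

Lemma thom_map_sub : zmod_morphism thom_map.
Proof. by move=> x y; apply/val_inj; rewrite /= rmorphB. Qed.

Lemma thom_map_mul : monoid_morphism thom_map.
Proof. by split=> [|x y]; apply/val_inj; rewrite /= ?rmorph1 ?rmorphM. Qed.

HB.instance Definition _ := GRing.isZmodMorphism.Build _ _ thom_map thom_map_sub.
HB.instance Definition _ := GRing.isMonoidMorphism.Build _ _ thom_map thom_map_mul.

Lemma thom_mapE x p : thom_map x p = thom_eval p x.
Proof. by rewrite ffunE. Qed.

(** A facet containing [F] is the wall of an edge at [p] outside [F]; its variable evaluates to the
    class of that edge, which [rho F p] sends back to the variable. *)
Lemma rho_thom_eval F p x : p \in (face_val F).1 ->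
  rho F p (thom_eval p (fkill F x)) = fkill F x.
Proof.
move=> pF; apply: (rmorph_vpoly_eq (f := rho F p \o thom_eval p \o fkill F)) => K /=.
rewrite fkill_face_var; have [->|_] := eqVneq K \bot%O; first by rewrite face_var_bot !rmorph1.
case: ifP => [/andP[wK FK]|_]; last by rewrite !rmorph0.
have [e ep KE] := is_wallP wK (sub_face_vert FK pF).
rewrite thom_eval_face_var KE -ep thom_wall rho_alpha ?ep // ifN //.
by rewrite -sub_wall -?KE ?ep.
Qed.

Lemma restrict_thom F g : restrict F (thom_map (face_var F * fkill F g)) =
  (\prod_(e in star (face_vert F) | e \notin (face_val F).2) face_var (wall e)) * fkill F g.
Proof.
rewrite /restrict thom_mapE rmorphM /= thom_eval_face_var rmorphM /=.
by rewrite rho_thom ?rho_thom_eval ?face_vertP.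
Qed.

(** With [restrict_thom], this makes the restrictions of Thom classes triangular for inclusion of
    faces. *)
Lemma restrict_thom0 F K g : ~~ sub_leq F K -> restrict F (thom_map (face_var K * g)) = 0.
Proof.
move=> FK; rewrite /restrict thom_mapE rmorphM /= thom_eval_face_var rmorphM /=.
by rewrite rho_thom0 ?face_vertP ?mul0r.
Qed.

End Restriction.

(** * Normal forms: independence and surjectivity *)

Section NormalForm.
Variables (n : nat) (G : torus_graph n).
Implicit Types (p q : vert G) (e : edge G) (F K L : face G).

Local Notation poly := (vpoly (face G) int).

Lemma sub_leq_refl F : sub_leq F F.
Proof. by rewrite /sub_leq !subxx. Qed.

(** The measure for inductions that go from large faces to small ones. *)
Definition superfaces F : nat := #|[set K : face G | sub_leq F K]|.

Lemma ltn_superfaces F K : sub_leq F K -> K != F -> (superfaces K < superfaces F)%N.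
Proof.
move=> FK KF; apply/proper_card/properP; split.
  by apply/subsetP => L; rewrite !inE; apply: sub_leq_trans.
exists F; rewrite !inE ?sub_leq_refl //; apply: contraNN KF => KF.
by apply/eqP; apply: face_le_anti; rewrite /face_le FK.
Qed.

(* v_F times a polynomial in the facets containing F: unlike the monomials in
   chains of faces, these are stable under products without any straightening
   order, and they still form a basis. *)
Definition normal_form (g : face G -> poly) : poly := \sum_F face_var F * fkill F (g F).

Lemma restrict_thom_sum F (I : finType) (x : I -> poly) :
  restrict F (thom_map (\sum_i x i)) = \sum_i restrict F (thom_map (x i)).
Proof.
apply: (big_morph (fun y => restrict F (thom_map y))) => [y z|];
  by rewrite /restrict !thom_mapE ?rmorphD ?rmorph0.
Qed.

(** The facet variables are nonzero in a domain, so they cancel. Only [fkill F (g F)], not [g F], is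
    determined, hence a conclusion about the sum. *)
Lemma normal_form_inj g : thom_map (normal_form g) = 0 -> normal_form g = 0.
Proof.
move=> g0; suff gF0 F : fkill F (g F) = 0.
  by rewrite /normal_form big1 // => F _; rewrite gF0 mulr0.
have [m] := ubnP (superfaces F); elim: m F => // m IH F; rewrite ltnS => Fm.
have : restrict F (thom_map (normal_form g)) = 0 by rewrite g0 /restrict ffunE rmorph0.
rewrite /normal_form restrict_thom_sum (bigD1 F) //=.
rewrite [X in X + _]restrict_thom [X in _ + X]big1 => [|K KF].
  rewrite addr0 => /eqP; rewrite mulf_eq0 => /orP[|/eqP //].
  by rewrite prodf_seq_eq0 => /hasP[e _]; rewrite (negPf (face_var_neq0 _)) andbF.
have [FK|/restrict_thom0->//] := boolP (sub_leq F K).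
by rewrite IH ?mulr0 ?rmorph0 /restrict ?ffunE ?rmorph0 // (leq_trans (ltn_superfaces FK KF)).
Qed.

Lemma mkill_face_var K i : K = val (enum_val i) -> forall L,
  mkill i (face_var L) = if L == K then 0 else face_var L.
Proof.
move=> KE L; have Kb : K != \bot%O by rewrite KE (valP (enum_val i)).
have [->|Lb] := eqVneq L \bot%O; first by rewrite face_var_bot rmorph1 eq_sym (negPf Kb).
have [j LE ->] := face_var_nonbot Lb; rewrite mkillX KE LE.
by rewrite (inj_eq val_inj) (inj_eq enum_val_inj).
Qed.

(** Among the facets containing [F], only [wall e] can fail to contain [K], so killing its variable
    passes from [F] to [K]. *)
Lemma mkill_fkill F K e i : wall e = val (enum_val i) ->
    src e \in (face_val F).1 -> sub_leq F K ->
    (forall e', src e' = src e ->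
       (e' \in (face_val K).2) = (e' \in (face_val F).2) || (e' == e)) ->
  forall x, mkill i (fkill F x) = fkill K x.
Proof.
move=> iE eF FK KE; apply: (rmorph_vpoly_eq (f := mkill i \o fkill F)) => L /=.
have kb : mkill i 1 = 1 by exact: rmorph1.
rewrite !fkill_face_var; have [->|Lb] := eqVneq L \bot%O; first by rewrite face_var_bot kb.
have [wL|//] := boolP (is_wall L); last by rewrite /= rmorph0.
have [FL|FL] /= := boolP (sub_leq F L); last first.
  rewrite rmorph0 ifN //; apply: contraNN FL; exact: sub_leq_trans.
have [e' se' LE] := is_wallP wL (sub_face_vert FL eF).
have e'F : src e' \in (face_val F).1 by rewrite se'.
rewrite (mkill_face_var iE) LE sub_wall ?(sub_face_vert FK) // KE //.
rewrite LE sub_wall // in FL; rewrite (negPf FL) /= if_neg.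
suff -> : (wall e' == wall e) = (e' == e) by [].
by apply/eqP/eqP => [/wall_inj|->]; last by []; apply.
Qed.

Lemma rho_mkill F e i (x : HBT n) : wall e = val (enum_val i) ->
    src e \in (face_val F).1 -> e \notin (face_val F).2 ->
  exists2 K : face G, sub_leq F K && (K != F) & mkill i (rho F (src e) x) = rho K (src e) x.
Proof.
move=> iE eF eNF; pose K := face_span (src e) ((face_val F).2 :|: [set e]).
have KE e' : src e' = src e ->
    (e' \in (face_val K).2) = (e' \in (face_val F).2) || (e' == e).
  by move=> se; rewrite face_spanE // !inE.
have FK : sub_leq F K.
  by apply/(sub_faceP eF (face_spanV _ _)) => e' se e'F; rewrite KE // e'F.
exists K; last exact: (mkill_fkill iE eF FK KE).
rewrite FK; apply: contraNneq eNF => <-.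
by rewrite KE // eqxx orbT.
Qed.

(** Killing the variable of a facet containing [F] amounts to restricting to a strictly larger face,
    where [f] vanishes; so each such variable divides, and hence their product. *)
Lemma restrict_dvd F (f : eqcoh G) :
    (forall K, sub_leq F K -> K != F -> restrict K f = 0) ->
  exists g, restrict F f =
    (\prod_(e in star (face_vert F) | e \notin (face_val F).2) face_var (wall e)) * fkill F g.
Proof.
move=> K0; set p := face_vert F; have pF : p \in (face_val F).1 := face_vertP F.
have [ix ixE ixX] : exists2 ix, forall e, wall e = val (enum_val (ix e)) &
    forall e : edge G, face_var (wall e) = 'X_(ix e).
  exists (fun e => s2val (face_var_wall e)) => e; first exact: (s2valP (face_var_wall e)).
  exact: (s2valP' (face_var_wall e)).
pose s := [seq e <- index_enum (edge G) | (e \in star p) && (e \notin (face_val F).2)].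
have sP e : e \in s -> src e = p /\ e \notin (face_val F).2.
  by rewrite mem_filter inE => /andP[/andP[/eqP]].
have us : uniq (map ix s).
  rewrite map_inj_in_uniq; first by rewrite filter_uniq ?index_enum_uniq.
  move=> e e' /sP[ep _] /sP[e'p _] ii.
  by apply: wall_inj; [rewrite ep | rewrite !ixE ii].
have [i /mapP[e es ->]|g gE] := dvd_prod_vars (p := restrict F f) us.
  have [ep eF] := sP e es.
  rewrite (restrictE f pF) -ep.
  have eVF : src e \in (face_val F).1 by rewrite ep.
  have [K /andP[FK KF] ->] := rho_mkill (f (src e)) (ixE e) eVF eF.
  by rewrite -restrictE ?K0 // ep (sub_face_vert FK).
exists g.
(* Applying [fkill F] fixes the restriction and these variables, and brings the cofactor into the
   required subring. *)
have rE : fkill F (restrict F f) = restrict F f.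
  by rewrite /restrict /rho /= fkill_sub ?sub_leq_refl.
rewrite -rE {1}gE rmorphM rmorph_prod /= big_map -[in RHS]big_filter -/s; congr (_ * _).
rewrite big_seq [RHS]big_seq; apply: eq_bigr => e /sP[ep eF].
by rewrite -ixX fkill_wall ?ep // (negPf eF).
Qed.

(** On the face reduced to the vertex [p] nothing is killed, so there [rho] is injective, with left
    inverse [thom_eval p]. *)
Lemma restrict_eq0 (f : eqcoh G) : (forall F, restrict F f = 0) -> f = 0.
Proof.
move=> f0; apply/val_inj/ffunP => p; rewrite [RHS]ffunE.
pose F := face_span p set0; have pF : p \in (face_val F).1 := face_spanV p set0.
have rK : cancel (rho F p) (thom_eval p).
  apply: (star_rmorph_eq (p := p) (f := thom_eval p \o rho F p) (g := idfun)) => e ep /=.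
  by rewrite -ep rho_alpha ?ep // face_spanE // inE -ep thom_eval_face_var thom_wall.
by rewrite -[LHS]rK -[val f]/(eqcoh_val f) -restrictE // f0 rmorph0.
Qed.

Lemma thom_map_surj (f : eqcoh G) : exists x, thom_map x = f.
Proof.
(* [U] is a set of faces, closed under enlargement, on which the restrictions already vanish; the
   induction is on the size of its complement. *)
suff peel m (U : {set face G}) : (#|~: U| < m)%N ->
    (forall F K, F \in U -> sub_leq F K -> K \in U) ->
    forall f : eqcoh G, (forall F, F \in U -> restrict F f = 0) -> exists x, thom_map x = f.
  by apply: (peel _ set0 (ltnSn _)) => F; rewrite inE.
elim: m U => // m IH U; rewrite ltnS => Um upU {}f fU.
have [U1|/subsetPn[F0 _ F0U]] := boolP ([set: face G] \subset U).
  exists 0; rewrite rmorph0; apply/esym/restrict_eq0 => F.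
  by apply/fU/(subsetP U1); rewrite inE.
(* A face outside [U] with fewest superfaces has all its strictly larger faces in [U]. *)
have [F FU Fmin] := arg_minnP (P := [pred F | F \notin U]) superfaces F0U.
have upF K : sub_leq F K -> K != F -> K \in U.
  by move=> FK KF; apply: contraTT (ltn_superfaces FK KF) => /Fmin; rewrite -leqNgt.
have [K FK KF|g gE] := @restrict_dvd F f; first by rewrite fU ?upF.
have [|||x xE] := IH (F |: U) _ _ (f - thom_map (face_var F * fkill F g)).
- apply: leq_trans Um; apply: proper_card; rewrite properC; apply/properP.
  by split; [exact: subsetUr | exists F; rewrite // setU11].
- move=> K L /setU1P[->|KU] KL; rewrite in_setU1; last by rewrite (upU K L) ?orbT.
  by have [//|LF] := eqVneq L F; rewrite upF ?orbT.
- move=> K KFU; have -> : restrict K (f - thom_map (face_var F * fkill F g)) =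
      restrict K f - restrict K (thom_map (face_var F * fkill F g)).
    by rewrite /restrict !ffunE rmorphB.
  case/setU1P: KFU => [->|KU]; first by rewrite restrict_thom gE subrr.
  (* The correction does not disturb [K]: if [K] were contained in [F], then [F] would be in [U]. *)
  rewrite fU // restrict_thom0 ?subrr //; apply: contraNN FU.
  exact: upU KU.
by exists (x + face_var F * fkill F g); rewrite rmorphD /= xE subrK.
Qed.

End NormalForm.

(** * Joins, components and straightening *)

Section Relations.
Variables (n : nat) (G : torus_graph n).
Implicit Types (p q : vert G) (e : edge G) (E F H K L : face G).

Local Notation poly := (vpoly (face G) int).
Local Notation is_comp F H K := (face_val K \in components (inter F H)).

Lemma face_spanP p (S : {set edge G}) K : p \in (face_val K).1 ->
    (forall e, src e = p -> (e \in (face_val K).2) = (e \in S)) ->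
  K = face_span p S.
Proof.
move=> pK KS; apply: (face_eq_star pK (face_spanV p S)); apply/setP => e.
by rewrite !inE; case: eqP => //= ep; rewrite KS // face_spanE.
Qed.

Definition face_join := locked (@fjoin n G).

Lemma face_joinE F H : fjoin F H = face_join F H.
Proof. by rewrite /face_join -lock. Qed.

(** The edges of [F] and [H] at [p] lie in every face containing both, so the face they span is the
    least one, and [fjoin] does not reach its default. *)
Lemma face_join_span F H p : p \in (face_val F).1 -> p \in (face_val H).1 ->
  face_join F H = face_span p ((face_val F).2 :|: (face_val H).2).
Proof.
move=> pF pH; set J := face_span _ _.
have pJ : p \in (face_val J).1 := face_spanV _ _.
have JE e : src e = p ->
    (e \in (face_val J).2) = (e \in (face_val F).2) || (e \in (face_val H).2).
  by move=> ep; rewrite face_spanE // inE.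
have FJ : sub_leq F J by apply/(sub_faceP pF pJ) => e ep eF; rewrite JE ?eF.
have HJ : sub_leq H J by apply/(sub_faceP pH pJ) => e ep eH; rewrite JE ?eH ?orbT.
have Jmin K : sub_leq F K -> sub_leq H K -> sub_leq J K.
  move=> FK HK; apply/(sub_faceP pJ (sub_face_vert FK pF)) => e ep.
  by rewrite JE // => /orP[]; apply: sub_face_edge.
rewrite -face_joinE /fjoin; case: pickP => [K /and3P[FK HK /forallP/(_ J)]|/(_ J)] /=.
  by rewrite FJ HJ Jmin //= => /eqP.
rewrite FJ HJ /= => /negP[]; apply/forallP => K; apply/implyP => /and3P[FK HK KJ].
by apply/eqP/face_le_anti; rewrite /face_le KJ Jmin.
Qed.

(** A component through [p] has at [p] all the edges common to [F] and [H]; hence at most one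
    component passes through [p]. *)
Lemma comp_vertP F H K p : is_comp F H K -> p \in (face_val K).1 ->
  [/\ p \in (face_val F).1, p \in (face_val H).1 &
      K = face_span p ((face_val F).2 :&: (face_val H).2)].
Proof.
move=> /imsetP[q qI KE] pK; have := pK; rewrite {1}KE inE /= inE => /andP[/andP[pF pH] qp].
split=> //; apply: face_spanP => // e ep.
by rewrite KE inE ep qp andbT.
Qed.

Lemma comp_span F H p : p \in (face_val F).1 -> p \in (face_val H).1 ->
  is_comp F H (face_span p ((face_val F).2 :&: (face_val H).2)).
Proof.
move=> pF pH.
have pI : p \in (inter F H).1 by rewrite inE pF.
have cI : component (inter F H) p \in components (inter F H) by apply: imset_f.
pose K := Face (components_faces cI).
have cK : is_comp F H K by [].
have pK : p \in (face_val K).1 by rewrite inE pI connect0.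
by have [_ _ <-] := comp_vertP cK pK.
Qed.

Lemma comp_sub F H K : is_comp F H K -> sub_leq K F /\ sub_leq K H.
Proof.
move=> /imsetP[q qI KE]; rewrite KE /sub_leq.
by split; apply/andP; split; apply/subsetP => x; rewrite !inE => /andP[/andP[]].
Qed.

Lemma comp_eq F H K p : is_comp F H K ->
  p \in (face_val F).1 -> p \in (face_val H).1 ->
  K != face_span p ((face_val F).2 :&: (face_val H).2) -> p \notin (face_val K).1.
Proof. by move=> cK pF pH; apply: contraNN => /(comp_vertP cK)[_ _ ->]. Qed.

Lemma thom0 F p : p \notin (face_val F).1 -> thom F p = 0.
Proof. by move=> /negPf pF; rewrite ffunE pF. Qed.

(** At a common vertex only the component through [p] contributes, and each [alpha e] occurs equally
    often on both sides: missing from [F] and [H], or from their union and intersection. Elsewhere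
    both sides vanish. *)
Lemma thom_eval_rel FH p : thom_eval p (thom_rel FH) = 0.
Proof.
case: FH => F H; rewrite /thom_rel /= !face_varE face_joinE rmorphB !rmorphM rmorph_sum /=.
under eq_bigr do rewrite face_varE thom_eval_face_var.
rewrite !thom_eval_face_var.
have [/andP[pF pH]|pFH] := boolP ((p \in (face_val F).1) && (p \in (face_val H).1)); last first.
  rewrite [X in _ - _ * X]big1 => [|K cK].
    by rewrite mulr0 subr0; case/nandP: pFH => /thom0 ->; rewrite ?mul0r ?mulr0.
  by rewrite thom0 //; apply: contraNN pFH => /(comp_vertP cK)[-> -> _].
rewrite (bigD1 (face_span p ((face_val F).2 :&: (face_val H).2))) /=; last exact: comp_span.
rewrite [X in _ - _ * (_ + X)]big1 => [|K /andP[cK KN]]; last first.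
  by rewrite thom0 // (comp_eq cK).
rewrite addr0 (face_join_span pF pH) !thomE ?face_spanV // !big_mkcondr -!big_split /=.
apply/eqP; rewrite subr_eq0; apply/eqP/eq_bigr => e; rewrite inE => /eqP ep.
rewrite !face_spanE // !inE.
by case: (e \in _) => /=; case: (e \in _) => /=; rewrite ?mulr1 ?mul1r.
Qed.

(* The relations are used in an abstract ring, as computing in the quotient
   makes unification diverge. *)
Section Straightening.
Variables (Q : comPzRingType) (h : {rmorphism poly -> Q}).
Local Notation tc F := (h (face_var F)).
Variable h_rel : forall F H,
  tc F * tc H = tc (face_join F H) * \sum_(K : face G | is_comp F H K) tc K.

Lemma rel_disjoint F H :
  (forall p, p \in (face_val F).1 -> p \notin (face_val H).1) -> tc F * tc H = 0.
Proof.
move=> FH; rewrite h_rel big1 ?mulr0 // => K cK.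
have [pF pH _] := comp_vertP cK (face_vertP K).
by rewrite (negPf (FH _ pF)) in pH.
Qed.

(** The wall of [e] and the face spanned by the edges off the shorter list have the whole graph as
    join, so their product is the sum over components of their intersection; the factor for [E]
    leaves only the one through [p]. *)
Lemma rel_walls p E (s : seq (edge G)) : p \in (face_val E).1 -> uniq s ->
    (forall e, e \in s -> src e = p /\ e \notin (face_val E).2) ->
  tc E * \prod_(e <- s) tc (wall e) = tc E * tc (face_span p [set e | e \notin s]).
Proof.
move=> pE; elim: s => [_ _|e s IH /= /andP[es us] sE].
  have -> : face_span p [set e | e \notin [::]] = \bot%O.
    by apply/esym/face_spanP => [|e _]; rewrite !in_setT ?inE.
  by rewrite big_nil face_var_bot rmorph1.
have [ep eE] := sE e (mem_head _ _).
have pW : p \in (face_val (wall e)).1 by rewrite -ep wallV.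
have EW : sub_leq E (wall e) by rewrite sub_wall ?ep.
pose H := face_span p [set e | e \notin s].
have pH : p \in (face_val H).1 := face_spanV _ _.
have EH : sub_leq E H.
  apply/(sub_faceP pE pH) => x xp xE; rewrite face_spanE // inE.
  by apply: contraL xE => xs; have [|] := sE x; rewrite // inE xs orbT.
have {}IH := IH us (fun x xs => sE x (mem_behead (s := e :: s) xs)).
rewrite big_cons mulrCA IH -/H mulrCA h_rel (face_join_span pW pH).
have -> : face_span p ((face_val (wall e)).2 :|: (face_val H).2) = \bot%O.
  apply/esym/face_spanP => [|x xp]; rewrite !in_setT // inE wallE ?ep // face_spanE // inE.
  by have [->|] := eqVneq x e.
rewrite face_var_bot rmorph1 mul1r.
rewrite (bigD1 (face_span p ((face_val (wall e)).2 :&: (face_val H).2))) /=; last first.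
  exact: comp_span.
rewrite mulrDr [X in _ + X]mulr_sumr [X in _ + X]big1 => [|K /andP[cK KN]].
  rewrite addr0; congr (_ * tc _); apply: face_spanP; first exact: face_spanV.
  by move=> x xp; rewrite face_spanE // !inE wallE ?ep // face_spanE // !inE negb_or.
(* A component meeting [E] contains [E], as both intersected faces do; it then passes through [p]
   and is the component already set apart. *)
apply: rel_disjoint => q qE; apply: contraNN KN => qK.
have [qW qH KE] := comp_vertP cK qK.
suff EK : sub_leq E K by have [_ _ {1}->] := comp_vertP cK (sub_face_vert EK pE).
apply/(sub_faceP qE qK) => x xq xE.
by rewrite KE face_spanE // inE (sub_face_edge EW) ?(sub_face_edge EH).
Qed.

(** This is [rel_walls] for the edges at [p] missing from [H]: the remaining ones span [H]. *)
Lemma rel_split p E H : p \in (face_val E).1 -> sub_leq E H ->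
  tc E * tc H = tc E * \prod_(e in star p | e \notin (face_val H).2) tc (wall e).
Proof.
move=> pE EH; rewrite -big_filter (rel_walls pE) ?filter_uniq ?index_enum_uniq //.
  congr (_ * tc _); apply: face_spanP; first exact: sub_face_vert pE.
  by move=> e ep; rewrite !inE mem_filter inE ep eqxx mem_index_enum andbT negbK.
move=> e; rewrite mem_filter inE => /andP[/andP[/eqP ep eH] _]; split=> //.
by apply: contraNN eH; apply: sub_face_edge.
Qed.

Definition has_normal_form (z : Q) := exists g, z = h (normal_form g).

Lemma has_normal_formB z z' :
  has_normal_form z -> has_normal_form z' -> has_normal_form (z - z').
Proof.
move=> [g ->] [g' ->]; exists (fun F => g F - g' F); rewrite -rmorphB; congr (h _).
rewrite /normal_form -sumrB; apply: eq_bigr => F _.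
by rewrite rmorphB /= mulrBr.
Qed.

Lemma has_normal_form0 : has_normal_form 0.
Proof.
exists (fun=> 0); rewrite /normal_form big1 ?rmorph0 // => F _.
by rewrite rmorph0 mulr0.
Qed.

Lemma has_normal_formD z z' :
  has_normal_form z -> has_normal_form z' -> has_normal_form (z + z').
Proof.
move=> nz nz'; rewrite -[z']opprK; apply: has_normal_formB => //.
by rewrite -sub0r; apply: has_normal_formB => //; apply: has_normal_form0.
Qed.

Lemma has_normal_form_fkill K x : has_normal_form (tc K * h (fkill K x)).
Proof.
exists (fun F => if F == K then x else 0); rewrite -rmorphM /normal_form (bigD1 K) //= eqxx.
by rewrite [X in _ + X]big1 ?addr0 // => F /negPf ->; rewrite rmorph0 mulr0.
Qed.

(** Multiplying v_F g_F by v_H gives terms v_K v_J g_F, with K a component of the intersection and J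
    the join. In the presence of v_K, [rel_split] turns v_J into a product of facets containing J,
    hence K; those in g_F contain F, hence K. *)
Lemma normal_form_ex x : has_normal_form (h x).
Proof.
elim/vpoly_ring_ind: x => [|x y nx ny|H x [g xE]].
- have -> : h 1 = h (face_var \bot%O) * h (fkill \bot%O 1).
    by rewrite face_var_bot !rmorph1 mulr1.
  exact: has_normal_form_fkill.
- by rewrite rmorphB; apply: has_normal_formB.
rewrite rmorphM xE /normal_form rmorph_sum mulr_sumr.
elim/big_ind: _ => [||F _]; [exact: has_normal_form0 | exact: has_normal_formD |].
rewrite rmorphM mulrA h_rel -mulrA mulrCA mulr_suml.
elim/big_ind: _ => [||K cK]; [exact: has_normal_form0 | exact: has_normal_formD |].
pose J := face_join H F.
have [KH KF] := comp_sub cK; have vK := face_vertP K.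
have KJ : sub_leq K J.
  rewrite /J (face_join_span (sub_face_vert KH vK) (sub_face_vert KF vK)).
  apply/(sub_faceP vK (face_spanV _ _)) => e ep eK.
  by rewrite face_spanE // inE (sub_face_edge KH eK).
pose y := (\prod_(e in star (face_vert K) | e \notin (face_val J).2) face_var (wall e)) *
          fkill F (g F).
suff -> : h (face_var K) * (tc J * h (fkill F (g F))) = h (face_var K) * h (fkill K y).
  exact: has_normal_form_fkill.
rewrite mulrA (rel_split vK KJ) -mulrA -rmorph_prod -rmorphM -/y; congr (_ * h _).
rewrite /y rmorphM /= fkill_sub // rmorph_prod; congr (_ * _).
apply: eq_bigr => e /andP[]; rewrite inE => /eqP ep eJ.
rewrite /= fkill_wall ?ep // ifN //; apply: contraNN eJ; exact: sub_face_edge.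
Qed.

End Straightening.

End Relations.

(** * Weighted degrees under ring morphisms *)

Section WeightedMorphism.
Variables (m k : nat) (w : 'I_m -> nat) (u : 'I_k -> nat).
Variable f : {rmorphism {mpoly int[m]} -> {mpoly int[k]}}.
Variable f_homog : forall i, f 'X_i \is (w i).-homog for (wdeg u).

Lemma rmorph_monomial_homog mon : f 'X_[mon] \is (wdeg w mon).-homog for (wdeg u).
Proof.
rewrite mpolyXE_id rmorph_prod /= /wdeg.
elim/big_rec2: _ => [|i d x _ xd]; first exact: dhomog1.
by rewrite rmorphXn mulnC; apply: dhomogM => //; apply: dhomogMn.
Qed.

(** A monomial is sent into the degree given by its own weight, so graded components correspond. *)
Lemma rmorph_pihomog d p : pihomog (wdeg u) d (f p) = f (pihomog (wdeg w) d p).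
Proof.
rewrite [in RHS]pihomogE big_mkcond [p in LHS]mpolyE !raddf_sum /=.
apply: eq_bigr => mon _.
rewrite rmorphZint linearZ /=; have fm := rmorph_monomial_homog mon.
case: eqP => [dm|/eqP dm]; first by rewrite rmorphZint pihomog_dE // -dm.
by rewrite rmorph0 (pihomog_ne0 dm) ?scaler0.
Qed.

Lemma rmorph_homog d p : p \is d.-homog for (wdeg w) -> f p \is d.-homog for (wdeg u).
Proof. by rewrite !homog_piE rmorph_pihomog => /eqP ->. Qed.

End WeightedMorphism.

(** * Rank, dimension and degree *)

Section Ranks.
Variables (n : nat) (G : torus_graph n).
Implicit Types (p q : vert G) (e : edge G) (E F H K L : face G).

Lemma dim_star F p : p \in (face_val F).1 -> Defs.dim F = #|star_in F p|.
Proof.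
move=> pF; rewrite /Defs.dim; case: pickP => [k /and4P[_ _ /forall_inP/(_ p pF)/eqP-> _] //|].
by case: F pF => F /= /existsP[k kF] _ /(_ k); rewrite kF.
Qed.

Lemma codim_star F p : p \in (face_val F).1 ->
  #|star p :\: (face_val F).2| = (n - Defs.dim F)%N.
Proof.
move=> pF; rewrite (dim_star pF).
have /forall_inP/(_ p (in_setT _))/eqP := tg_regular G.
rewrite /star_in setIT -(cardsID (face_val F).2 (star p)) => nE.
by rewrite -[X in (X - _)%N]nE addKn.
Qed.

Lemma boolean_below_card (disp : Order.disp_t) (P : finBPOrderType disp) (s : P) k :
  boolean_below s k -> #|[set t | (t <= s)%O]| = (2 ^ k)%N.
Proof.
move=> /existsP[f /andP[/forallP f_le /forallP f_im]].
have -> : [set t | (t <= s)%O] = [set f A | A : {set 'I_k}].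
  apply/setP => t; rewrite inE (eqP (f_im t)).
  by apply/codomP/imsetP => [[A ->]|[A _ ->]]; exists A.
rewrite card_imset; first by rewrite -cardsT -powersetT card_powerset cardsT card_ord.
move=> A B fAB.
have le_f C D : (f C <= f D)%O = (C \subset D) by apply/eqP; have /forallP := f_le C; apply.
by apply/eqP; rewrite eqEsubset -!le_f fAB lexx.
Qed.

(** Counting the lower segment makes [k] unique, and k < 2 ^ k puts it in the range searched by
    [rk]. *)
Lemma boolean_below_rk (disp : Order.disp_t) (P : finBPOrderType disp) (s : P) k :
  boolean_below s k -> rk s = k.
Proof.
move=> sk; have c := boolean_below_card sk.
have k_lt : (k < #|P|)%N.
  by apply: leq_trans (ltn_expl k (ltnSn 1)) _; rewrite -c max_card.
rewrite /rk; case: pickP => [j /boolean_below_card|/(_ (Ordinal k_lt))]; last by rewrite sk.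
by rewrite c => /eqP; rewrite eqn_exp2l // => /eqP.
Qed.

Lemma rk_face F : rk F = (n - Defs.dim F)%N.
Proof. by have [p pF /boolean_below_rk ->] := boolean_below_face F; apply: codim_star. Qed.

Lemma thom_homog F p : thom F p \is (2 * (n - Defs.dim F)).-homog for (wdeg (fun=> 2%N)).
Proof.
have [pF|pF] := boolP (p \in (face_val F).1); last by rewrite thom0 ?rpred0.
rewrite thomE // -(codim_star pF) -sum1dep_card big_distrr /=.
have -> : (\sum_(e | (e \notin (face_val F).2) && (e \in star p)) 2 * 1 =
           \sum_(e in star p | e \notin (face_val F).2) 2)%N.
  by apply: eq_bigl => e; rewrite andbC.
elim/big_rec2: _ => [|e d x _ xd]; first exact: dhomog1.
by apply: dhomogM => //; apply: linform_homog.
Qed.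

Lemma thom_eval_homog p i : thom_eval p 'X_i \is (@fwt n G i).-homog for (wdeg (fun=> 2%N)).
Proof. by rewrite -face_var_enum thom_eval_face_var; apply: thom_homog. Qed.

End Ranks.

(** * Poset relations as Thom relations *)

Section FaceRelations.
Variables (n : nat) (G : torus_graph n).
Implicit Types (p q : vert G) (e : edge G) (E F H K L : face G).

Local Notation is_comp F H K := (face_val K \in components (inter F H)).

(** For reversed inclusion, minimal upper bounds are the maximal faces inside both [F] and [H];
    through a given vertex this is the face spanned by the common edges, which is the component. *)
Lemma mem_mub F H K : (K \in mub F H) = is_comp F H K.
Proof.
have meet_sup p E : p \in (face_val F).1 -> p \in (face_val H).1 -> p \in (face_val E).1 ->
    sub_leq E F -> sub_leq E H ->
    sub_leq E (face_span p ((face_val F).2 :&: (face_val H).2)).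
  move=> pF pH pE EF EH; apply/(sub_faceP pE (face_spanV _ _)) => e ep eE.
  by rewrite face_spanE // inE (sub_face_edge EF) ?(sub_face_edge EH).
rewrite inE; apply/idP/idP => [/and3P[KF KH /forallP Kmin]|cK].
  have pK := face_vertP K.
  have pF := sub_face_vert KF pK; have pH := sub_face_vert KH pK.
  have cK := comp_span pF pH.
  have [K0F K0H] := comp_sub cK.
  have := Kmin (face_span (face_vert K) ((face_val F).2 :&: (face_val H).2)).
  rewrite [(F <= _)%O]K0F [(H <= _)%O]K0H [(_ <= K)%O]meet_sup //=.
  by move/eqP => <-.
have [KF KH] := comp_sub cK.
rewrite [(F <= _)%O]KF [(H <= _)%O]KH /=.
apply/forallP => L; apply/implyP => /and3P[LF LH KL].
have pK := face_vertP K; have [pF pH KE] := comp_vertP cK pK.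
apply/eqP/le_anti; rewrite KL /= {1}KE.
exact: (meet_sup _ _ pF pH (sub_face_vert KL pK) LF LH).
Qed.

Lemma glb_join F H p : p \in (face_val F).1 -> p \in (face_val H).1 ->
  glb F H = face_join F H.
Proof.
move=> pF pH; rewrite (face_join_span pF pH); set J := face_span _ _.
have pJ : p \in (face_val J).1 := face_spanV _ _.
have JE e : src e = p ->
    (e \in (face_val J).2) = (e \in (face_val F).2) || (e \in (face_val H).2).
  by move=> ep; rewrite face_spanE // inE.
have FJ : (J <= F)%O by apply/(sub_faceP pF pJ) => e ep eF; rewrite JE ?eF.
have HJ : (J <= H)%O by apply/(sub_faceP pH pJ) => e ep eH; rewrite JE ?eH ?orbT.
have Jmax K : (K <= F)%O -> (K <= H)%O -> (K <= J)%O.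
  move=> FK HK; apply/(sub_faceP pJ (sub_face_vert FK pF)) => e ep.
  by rewrite JE // => /orP[]; apply: sub_face_edge.
rewrite /glb; case: pickP => [K /and3P[KF KH /forallP/(_ J)]|/(_ J)] /=.
  by rewrite FJ HJ /= => JK; apply/le_anti; rewrite JK Jmax.
rewrite FJ HJ /= => /negP[]; apply/forallP => K; apply/implyP => /andP[KF KH].
exact: Jmax.
Qed.

Lemma face_rel_thom : @face_rel _ (face G) int = @thom_rel n G.
Proof.
apply/funext => -[F H]; rewrite /face_rel /thom_rel /fvar /=; congr (_ - _).
rewrite (eq_bigl _ _ (mem_mub F H)).
have [p /andP[pF pH]|none] := pickP [pred p | (p \in (face_val F).1) && (p \in (face_val H).1)].
  by rewrite (glb_join pF pH) face_joinE.
(* For disjoint faces [glb] and [fjoin] need not agree, but each multiplies an empty sum. *)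
have s0 : \sum_(K : face G | is_comp F H K) vgen int K = 0.
  apply: big1 => K cK; have [pF pH _] := comp_vertP cK (face_vertP K).
  by have := none (face_vert K); rewrite /= pF pH.
have x0 (x : vpoly (face G) int) :
    x * \sum_(K : face G | is_comp F H K) vgen int K = 0 by rewrite s0 mulr0.
exact: etrans (x0 _) (esym (x0 _)).
Qed.

End FaceRelations.

(** * Kernel and homogeneous preimages *)

Section Kernel.
Variables (n : nat) (G : torus_graph n).

Local Notation poly := (vpoly (face G) int).

Lemma thom_map_rel FH : thom_map (@thom_rel n G FH) = 0.
Proof. by apply/val_inj/ffunP => p; rewrite [RHS]ffunE thom_mapE thom_eval_rel. Qed.

Lemma thom_map_ideal x : x \in @thom_ideal n G -> thom_map x = 0.
Proof.
move=> /asboolP[c ->]; rewrite rmorph_sum big1 // => j _.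
by rewrite rmorphM /= thom_map_rel mulr0.
Qed.

Definition thom_proj : {rmorphism poly -> thom_ring G} :=
  \pi_{ideal_quot (@thom_ideal n G : idealr poly)}.

Lemma thom_proj_eq0 x : thom_proj x = 0 <-> x \in @thom_ideal n G.
Proof.
rewrite -[x in x \in _]subr0 [_ \in _]Quotient.idealrBE -(rmorph0 thom_proj).
by split=> [/eqP|/eqP].
Qed.

Lemma thom_proj_rel F H :
  thom_proj (face_var F) * thom_proj (face_var H) = thom_proj (face_var (face_join F H)) *
    \sum_(K : face G | face_val K \in components (inter F H)) thom_proj (face_var K).
Proof.
have : thom_proj (thom_rel (F, H)) = 0.
  apply/thom_proj_eq0/asboolP.
  exists (fun j => (j == (F, H))%:R); rewrite (bigD1 (F, H)) //= eqxx mul1r.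
  by rewrite big1 ?addr0 // => j /negPf ->; rewrite mul0r.
rewrite /thom_rel /= !face_varE face_joinE rmorphB !rmorphM rmorph_sum /= => /eqP.
under eq_bigr do rewrite face_varE.
by rewrite subr_eq0 => /eqP.
Qed.

(** Modulo the ideal, [x] is a normal form; its image is still 0, so [normal_form_inj] makes it
    vanish. *)
Lemma thom_ideal_kernel x : x \in @thom_ideal n G <-> thom_map x = 0.
Proof.
split=> [|x0]; first exact: thom_map_ideal.
have [g xg] := normal_form_ex (h := thom_proj) thom_proj_rel x.
have /thom_map_ideal : x - normal_form g \in @thom_ideal n G.
  by apply/thom_proj_eq0; rewrite rmorphB /= xg subrr.
rewrite rmorphB /= x0 sub0r => /eqP; rewrite oppr_eq0 => /eqP/normal_form_inj g0.
by apply/thom_proj_eq0; rewrite xg g0 rmorph0.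
Qed.

Lemma thom_map_homog d x : x \is d.-homog for (wdeg (@fwt n G)) -> eqcoh_homog d (thom_map x).
Proof.
move=> xd p; suff : thom_eval p x \is d.-homog for (wdeg (fun=> 2%N)) by rewrite -thom_mapE.
by apply: rmorph_homog xd; apply: thom_eval_homog.
Qed.

(** The degree [d] component of any preimage is again a preimage, as evaluation commutes with taking
    components. *)
Lemma thom_map_homog_surj d (f : eqcoh G) : eqcoh_homog d f ->
  exists2 x, x \is d.-homog for (wdeg (@fwt n G)) & thom_map x = f.
Proof.
have [x <-] := thom_map_surj f => fd; exists (pihomog (wdeg (@fwt n G)) d x).
  exact: pihomogP.
apply/val_inj/ffunP => p; rewrite !thom_mapE.
rewrite -(rmorph_pihomog (f := thom_eval p) (thom_eval_homog p)).
by apply: pihomog_dE; rewrite /= -thom_mapE; apply: fd.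
Qed.

End Kernel.

Theorem theorem5p5 (n : nat) (G : torus_graph n) :
  (exists phi : {rmorphism face_ring (face G) int -> eqcoh G},
     graded_iso (@face_ring_homog _ (face G) int) (@eqcoh_homog n G) phi)
  /\
  (exists phi : {rmorphism thom_ring G -> eqcoh G},
     graded_iso (@thom_ring_homog n G) (@eqcoh_homog n G) phi /\
     forall F : face G, eqcoh_val (phi (thom_class F)) = thom F).
Proof.
(* Ranks in the poset are codimensions, so the two presentations carry the same weights. *)
have wE : @vwt _ (face G) = @fwt n G.
  by apply/funext => i; rewrite /vwt rk_face.
split.
  (* The two ideals have the same generators by [face_rel_thom], so one kernel computation serves
     both. *)
  have ker x : x \in (@face_ideal _ (face G) int : idealr _) <-> thom_map x = 0.
    by rewrite -thom_ideal_kernel /thom_ideal -face_rel_thom.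
  have hom := @thom_map_homog n G; have hom' := @thom_map_homog_surj n G.
  rewrite -wE in hom hom'.
  have [phi [iso _]] := quot_graded_iso (I := @face_ideal _ (face G) int : idealr _)
    ker (@thom_map_surj n G) hom hom'.
  by exists phi.
have [phi [iso phiE]] := quot_graded_iso (I := @thom_ideal n G : idealr _)
  (@thom_ideal_kernel n G) (@thom_map_surj n G) (@thom_map_homog n G) (@thom_map_homog_surj n G).
exists phi; split=> // F; rewrite phiE face_varE.
by apply/ffunP => p; rewrite thom_mapE thom_eval_face_var.
Qed.
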